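(* Consider the reduced system $\dot x = G(x)$ on the open positive orthant $\mathbb{R}_{+}^4=(0,\infty)^4$, with state $x=(\mu_{34},s,\mu_{200},z)$, as defined in the context, and assume the parameter inequalities stated there. Assume in addition that the set of equilibria of this system in $\mathbb{R}_+^4$ is totally disconnected. Let $W^c\subseteq \mathbb{R}_+^4$ be the set of initial points whose forward orbit has compact closure contained in $\mathbb{R}_+^4$. Then for Lebesgue-almost every initial point $x_0\in W^c$, the forward trajectory starting at $x_0$ converges to an equilibrium.
   Context: All of the following are positive real parameters: $A_s, A_z, E_{34}, E_{200}, E_S, E_Z, \beta_{34}, \beta_{-34}, \beta_{200}, \beta_{-200}, \gamma_s, \gamma_z, c_s, c_{-s}, c_z, c_{-z}, \beta_s, \beta_{s1}, \beta_{s2}, \beta_z, \beta_{z1}, \beta_{z2}, k_s, k_{s1}, k_{s2}, k_{-s}, k_z, k_{z1}, k_{z2}, k_{-z}, \delta_z$. They satisfy $\beta_s<\beta_{s1}<\beta_{s2}$, $\beta_z<\beta_{z1}<\beta_{z2}$, $k_s>k_{s1}>k_{s2}$ and $k_z>k_{z1}>k_{z2}$. For $\rho\in\{s,z\}$ define $e_{\rho1}=\beta_{\rho1}\beta_{\rho2}+(\beta_{\rho1}+\beta_{\rho2})c_{-\rho}+c_{-\rho}^2$, $e_{\rho2}=c_\rho(\beta_{\rho2}+c_{-\rho})$, $e_{\rho3}=\beta_\rho\beta_{\rho2}+\beta_{\rho1}\beta_{\rho2}+\beta_{\rho1}c_{-\rho}$, $\Delta_\rho(\mu)=\beta_{\rho2}c_\rho^2\mu^2+e_{\rho3}c_\rho\mu+e_{\rho1}\beta_\rho$,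 and $N_\rho(\mu)=\dfrac{k_\rho(\beta_{\rho2}c_\rho\mu+e_{\rho1})+k_{\rho1}e_{\rho2}\mu+k_{\rho2}c_\rho^2\mu^2}{\Delta_\rho(\mu)}$ for $\mu\ge 0$. The reduced system $\dot x=G(x)$, $x=(\mu_{34},s,\mu_{200},z)$, is $\dot\mu_{34}=\dfrac{\beta_{34}E_{34}A_sA_z}{(s^2+A_s)(z^2+A_z)}-\beta_{-34}\mu_{34}$, $\dot s=\dfrac{\gamma_sE_SA_s}{s^2+A_s}N_s(\mu_{34})-k_{-s}s$, $\dot\mu_{200}=\dfrac{\beta_{200}E_{200}A_sA_z}{(s^2+A_s)(z^2+A_z)}-\beta_{-200}\mu_{200}$, $\dot z=\delta_z+\dfrac{\gamma_zE_Zs^2z^2}{(s^2+A_s)(z^2+A_z)}N_z(\mu_{200})-k_{-z}z$. *)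

(* Defs.v *)
From Stdlib Require Import Reals Lra.
Open Scope R_scope.

Record P4 := mkP4 { mu34 : R; sv : R; mu200 : R; zv : R }.

Record Params := mkParams {
  A_s : R; A_z : R; E_34 : R; E_200 : R; E_S : R; E_Z : R;
  beta_34 : R; beta_m34 : R; beta_200 : R; beta_m200 : R;
  gamma_s : R; gamma_z : R; c_s : R; c_ms : R; c_z : R; c_mz : R;
  beta_s : R; beta_s1 : R; beta_s2 : R; beta_z : R; beta_z1 : R; beta_z2 : R;
  k_s : R; k_s1 : R; k_s2 : R; k_ms : R; k_z : R; k_z1 : R; k_z2 : R; k_mz : R;
  delta_z : R }.

Definition params_ok (p : Params) : Prop :=
  0 < A_s p /\ 0 < A_z p /\ 0 < E_34 p /\ 0 < E_200 p /\ 0 < E_S p /\ 0 < E_Z p /\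
  0 < beta_34 p /\ 0 < beta_m34 p /\ 0 < beta_200 p /\ 0 < beta_m200 p /\
  0 < gamma_s p /\ 0 < gamma_z p /\ 0 < c_s p /\ 0 < c_ms p /\ 0 < c_z p /\ 0 < c_mz p /\
  0 < beta_s p /\ 0 < beta_s1 p /\ 0 < beta_s2 p /\
  0 < beta_z p /\ 0 < beta_z1 p /\ 0 < beta_z2 p /\
  0 < k_s p /\ 0 < k_s1 p /\ 0 < k_s2 p /\ 0 < k_ms p /\
  0 < k_z p /\ 0 < k_z1 p /\ 0 < k_z2 p /\ 0 < k_mz p /\ 0 < delta_z p /\
  beta_s p < beta_s1 p /\ beta_s1 p < beta_s2 p /\
  beta_z p < beta_z1 p /\ beta_z1 p < beta_z2 p /\
  k_s p > k_s1 p /\ k_s1 p > k_s2 p /\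
  k_z p > k_z1 p /\ k_z1 p > k_z2 p.

Definition e1 (b1 b2 cm : R) : R := b1 * b2 + (b1 + b2) * cm + cm ^ 2.
Definition e2 (c b2 cm : R) : R := c * (b2 + cm).
Definition e3 (b b1 b2 cm : R) : R := b * b2 + b1 * b2 + b1 * cm.
Definition Delta (b b1 b2 c cm mu : R) : R :=
  b2 * c ^ 2 * mu ^ 2 + e3 b b1 b2 cm * c * mu + e1 b1 b2 cm * b.
Definition Nfun (k k1 k2 b b1 b2 c cm mu : R) : R :=
  (k * (b2 * c * mu + e1 b1 b2 cm) + k1 * e2 c b2 cm * mu + k2 * c ^ 2 * mu ^ 2)
  / Delta b b1 b2 c cm mu.

Definition N_s (p : Params) (mu : R) : R :=
  Nfun (k_s p) (k_s1 p) (k_s2 p) (beta_s p) (beta_s1 p) (beta_s2 p) (c_s p) (c_ms p) mu.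
Definition N_z (p : Params) (mu : R) : R :=
  Nfun (k_z p) (k_z1 p) (k_z2 p) (beta_z p) (beta_z1 p) (beta_z2 p) (c_z p) (c_mz p) mu.

Definition G (p : Params) (x : P4) : P4 :=
  let s := sv x in let z := zv x in
  mkP4
    (beta_34 p * E_34 p * A_s p * A_z p / ((s ^ 2 + A_s p) * (z ^ 2 + A_z p))
       - beta_m34 p * mu34 x)
    (gamma_s p * E_S p * A_s p / (s ^ 2 + A_s p) * N_s p (mu34 x) - k_ms p * s)
    (beta_200 p * E_200 p * A_s p * A_z p / ((s ^ 2 + A_s p) * (z ^ 2 + A_z p))
       - beta_m200 p * mu200 x)
    (delta_z p + gamma_z p * E_Z p * s ^ 2 * z ^ 2 / ((s ^ 2 + A_s p) * (z ^ 2 + A_z p))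
       * N_z p (mu200 x) - k_mz p * z).

Definition in_orthant (x : P4) : Prop :=
  0 < mu34 x /\ 0 < sv x /\ 0 < mu200 x /\ 0 < zv x.

(* Max-norm distance on R^4 (induces the Euclidean topology). *)
Definition dist4 (x y : P4) : R :=
  Rmax (Rmax (Rabs (mu34 x - mu34 y)) (Rabs (sv x - sv y)))
       (Rmax (Rabs (mu200 x - mu200 y)) (Rabs (zv x - zv y))).

Definition open4 (U : P4 -> Prop) : Prop :=
  forall x, U x -> exists r, 0 < r /\ forall y, dist4 x y < r -> U y.

Definition connected4 (S : P4 -> Prop) : Prop :=
  ~ (exists U V : P4 -> Prop, open4 U /\ open4 V /\
       (forall x, S x -> U x \/ V x) /\
       (exists x, S x /\ U x) /\ (exists x, S x /\ V x) /\
       (forall x, S x -> U x -> V x -> False)).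

Definition totally_disconnected4 (S : P4 -> Prop) : Prop :=
  forall C : P4 -> Prop, (forall x, C x -> S x) -> connected4 C ->
    forall x y, C x -> C y -> x = y.

Definition equilibrium (p : Params) (e : P4) : Prop :=
  in_orthant e /\ G p e = mkP4 0 0 0 0.

Definition forward_solution (p : Params) (phi : R -> P4) (x0 : P4) : Prop :=
  phi 0 = x0 /\
  (forall t, 0 <= t -> in_orthant (phi t)) /\
  (forall t, 0 < t ->
     derivable_pt_lim (fun u => mu34 (phi u)) t (mu34 (G p (phi t))) /\
     derivable_pt_lim (fun u => sv (phi u)) t (sv (G p (phi t))) /\
     derivable_pt_lim (fun u => mu200 (phi u)) t (mu200 (G p (phi t))) /\
     derivable_pt_lim (fun u => zv (phi u)) t (zv (G p (phi t)))) /\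
  (forall eps, 0 < eps -> exists d, 0 < d /\
     forall t, 0 <= t < d -> dist4 (phi t) x0 < eps).

(* W^c: initial points whose forward orbit has compact closure inside the open
   orthant, i.e. the orbit stays in a compact box [d,M]^4 with d > 0. *)
Definition Wc (p : Params) (x0 : P4) : Prop :=
  exists phi, forward_solution p phi x0 /\
    exists d M, 0 < d /\ forall t, 0 <= t ->
      d <= mu34 (phi t) <= M /\ d <= sv (phi t) <= M /\
      d <= mu200 (phi t) <= M /\ d <= zv (phi t) <= M.

Definition converges_to (phi : R -> P4) (e : P4) : Prop :=
  forall eps, 0 < eps -> exists T, forall t, T <= t -> dist4 (phi t) e < eps.

Definition in_box (lo hi x : P4) : Prop :=
  mu34 lo <= mu34 x <= mu34 hi /\ sv lo <= sv x <= sv hi /\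
  mu200 lo <= mu200 x <= mu200 hi /\ zv lo <= zv x <= zv hi.

Definition box_vol (lo hi : P4) : R :=
  (mu34 hi - mu34 lo) * (sv hi - sv lo) * (mu200 hi - mu200 lo) * (zv hi - zv lo).

Definition lebesgue_null4 (S : P4 -> Prop) : Prop :=
  forall eps, 0 < eps -> exists lo hi : nat -> P4,
    (forall n, mu34 (lo n) <= mu34 (hi n) /\ sv (lo n) <= sv (hi n) /\
               mu200 (lo n) <= mu200 (hi n) /\ zv (lo n) <= zv (hi n)) /\
    (forall x, S x -> exists n, in_box (lo n) (hi n) x) /\
    (forall N, sum_f_R0 (fun n => box_vol (lo n) (hi n)) N <= eps).

(* Main.v *)
(** In the coordinates [(- mu34, s, - mu200, z)] the system is cooperative and irreducible, since
    [N_s] and [N_z] are strictly decreasing; hence its flow is strongly monotone.  By Hirsch's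
    arguments (no orbit has both a falling and a rising interval, so limit sets are unordered; the
    colimiting and absorption principles), two orbits with [x0 << y0] satisfy
    [omega(x0) <= omega(y0)], unless [omega(y0)] is a point or consists of equilibria; in the
    latter case it is also a point, being connected in a totally disconnected set.  An orbit that
    does not converge has limit points [u], [v] and a rational [r] with [u_i < r < v_i] for some
    coordinate [i].  For fixed [(i, r)] the corresponding initial points therefore form an
    antichain of the strict order [<<], and bounded antichains are Lebesgue null. *)

Require Import Defs.
From Stdlib Require Import Reals Lra Lia Psatz ZArith List Cantor FinFun.
From Stdlib Require Import Classical ClassicalEpsilon FunctionalExtensionality.
Open Scope R_scope.

(** * Vectors *)

Inductive ix := X1 | X2 | X3 | X4.
Definition V := ix -> R.

Definition vle (u v : V) : Prop := forall i, u i <= v i.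
Definition vll (u v : V) : Prop := forall i, u i < v i.
Definition near (e : R) (u v : V) : Prop := forall i, Rabs (u i - v i) < e.

Lemma vext (u v : V) : (forall i, u i = v i) -> u = v.
Proof. intro H; apply functional_extensionality; exact H. Qed.

Lemma vle_antisym u v : vle u v -> vle v u -> u = v.
Proof. intros H1 H2; apply vext; intro i; specialize (H1 i); specialize (H2 i); lra. Qed.

Lemma vle_refl u : vle u u.
Proof. intro i; lra. Qed.

Lemma vle_trans u v w : vle u v -> vle v w -> vle u w.
Proof. intros H1 H2 i; specialize (H1 i); specialize (H2 i); lra. Qed.

Lemma near_sym e u v : near e u v -> near e v u.
Proof. intros H i; rewrite Rabs_minus_sym; apply H. Qed.

Lemma near_weaken e e' u v : e <= e' -> near e u v -> near e' u v.
Proof. intros He H i; specialize (H i); lra. Qed.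

Lemma near_trans e e' u v w : near e u v -> near e' v w -> near (e + e') u w.
Proof.
  intros H1 H2 i; specialize (H1 i); specialize (H2 i).
  replace (u i - w i) with ((u i - v i) + (v i - w i)) by ring.
  eapply Rle_lt_trans; [apply Rabs_triang | lra].
Qed.

Lemma near_eq u v : (forall e, 0 < e -> near e u v) -> u = v.
Proof.
  intro H; apply vext; intro i.
  apply Rminus_diag_uniq, NNPP; intro Hn.
  pose proof (Rabs_pos_lt _ Hn) as Hp.
  specialize (H _ Hp i); lra.
Qed.

Lemma near_refl e u : 0 < e -> near e u u.
Proof. intros He i; rewrite Rminus_diag, Rabs_R0; exact He. Qed.

Lemma vle_closed u v :
  (forall e, 0 < e -> exists u' v', near e u' u /\ near e v' v /\ vle u' v') -> vle u v.
Proof.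
  intros H i; apply Rnot_lt_le; intro Hlt.
  destruct (H ((u i - v i) / 2)) as (u' & v' & Hu & Hv & Hle); [lra|].
  specialize (Hu i); specialize (Hv i); specialize (Hle i).
  apply Rabs_def2 in Hu; apply Rabs_def2 in Hv; lra.
Qed.

Lemma ix_uniform (P : ix -> R -> Prop) :
  (forall i e e', 0 < e' <= e -> P i e -> P i e') ->
  (forall i, exists e, 0 < e /\ P i e) -> exists e, 0 < e /\ forall i, P i e.
Proof.
  intros Hm H.
  destruct (H X1) as (a & Ha & Pa), (H X2) as (b & Hb & Pb),
    (H X3) as (c & Hc & Pc), (H X4) as (d & Hd & Pd).
  exists (Rmin (Rmin a b) (Rmin c d)).
  assert (Hp : 0 < Rmin (Rmin a b) (Rmin c d)) by (repeat apply Rmin_glb_lt; assumption).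
  pose proof (Rmin_l (Rmin a b) (Rmin c d)); pose proof (Rmin_r (Rmin a b) (Rmin c d)).
  pose proof (Rmin_l a b); pose proof (Rmin_r a b);
  pose proof (Rmin_l c d); pose proof (Rmin_r c d).
  split; [exact Hp|].
  intros [| | |]; (eapply Hm; [split; [exact Hp|] | eassumption]); lra.
Qed.

Lemma vll_margin u v : vll u v ->
  exists e, 0 < e /\ forall u' v', near e u' u -> near e v' v -> vll u' v'.
Proof.
  intro H.
  destruct (ix_uniform (fun i e => u i + 2 * e <= v i)) as (e & He & Hi).
  - intros i e e' He Hi; lra.
  - intro i; exists ((v i - u i) / 2); specialize (H i); split; lra.
  - exists e; split; [exact He|].
    intros u' v' Hu Hv i; specialize (Hi i); specialize (Hu i); specialize (Hv i).
    apply Rabs_def2 in Hu; apply Rabs_def2 in Hv; lra.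
Qed.

Lemma vll_vle u v : vll u v -> vle u v.
Proof. intros H i; specialize (H i); lra. Qed.

Lemma vll_neq u v : vll u v -> u <> v.
Proof. intros H E; subst; specialize (H X1); lra. Qed.

Lemma real_induction (P : R -> Prop) :
  P 0 ->
  (forall h, 0 < h -> (forall h', 0 <= h' < h -> P h') -> P h) ->
  (forall h, 0 <= h -> (forall h', 0 <= h' <= h -> P h') ->
     exists d, 0 < d /\ forall h', h <= h' <= h + d -> P h') ->
  forall h, 0 <= h -> P h.
Proof.
  intros P0 Pc Po h1 Hh1; apply NNPP; intro Hn.
  pose (E := fun h => 0 <= h /\ forall h', 0 <= h' <= h -> P h').
  destruct (completeness E) as (m & Hub & Hlub).
  - exists h1; intros h (Hh & HP); apply Rnot_lt_le; intro; apply Hn, HP; lra.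
  - exists 0; split; [lra|]; intros h' ?; replace h' with 0 by lra; exact P0.
  - assert (Hm0 : 0 <= m).
    { apply Hub; split; [lra|]; intros h' ?; replace h' with 0 by lra; exact P0. }
    assert (Hlt : forall h', 0 <= h' < m -> P h').
    { intros h' Hh'; apply NNPP; intro Hn'.
      assert (m <= h'); [|lra].
      apply Hlub; intros h (Hh & HP); apply Rnot_lt_le; intro; apply Hn', HP; lra. }
    assert (Hm : P m).
    { destruct (Rle_lt_or_eq_dec _ _ Hm0) as [Hpos | <-]; [apply Pc; assumption | exact P0]. }
    destruct (Po m Hm0) as (d & Hd & HP).
    + intros h' Hh'; destruct (Req_dec h' m) as [-> |]; [exact Hm | apply Hlt; lra].
    + assert (m + d <= m); [|lra].
      apply Hub; split; [lra|].
      intros h' Hh'; destruct (Rlt_le_dec h' m); [apply Hlt | apply HP]; lra.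
Qed.

(** * Limit sets of strongly monotone families of trajectories *)

Definition traj := R -> V.
Definition shift (t0 : R) (x : traj) : traj := fun t => x (t0 + t).

Definition Om (x : traj) (p : V) : Prop :=
  forall e T0, 0 < e -> exists t, T0 <= t /\ 0 <= t /\ near e (x t) p.
Definition Om2 (x y : traj) (a b : V) : Prop :=
  forall e T0, 0 < e -> exists t, T0 <= t /\ 0 <= t /\ near e (x t) a /\ near e (y t) b.

Record strongly_monotone (T : traj -> Prop) : Prop := {
  sm_bounded : exists B, forall x t i, T x -> 0 <= t -> Rabs (x t i) <= B;
  sm_ucont : forall e, 0 < e -> exists d, 0 < d /\ forall x s t, T x -> 0 <= s -> 0 <= t ->
    Rabs (t - s) <= d -> near e (x t) (x s);
  sm_shift : forall x t0, T x -> 0 <= t0 -> T (shift t0 x);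
  sm_mono : forall x y t, T x -> T y -> vle (x 0) (y 0) -> 0 <= t -> vle (x t) (y t);
  sm_strong : forall x y t, T x -> T y -> vle (x 0) (y 0) -> x 0 <> y 0 -> 0 < t ->
    vll (x t) (y t);
  sm_dep : forall t e, 0 <= t -> 0 < e -> exists d, 0 < d /\ forall x y, T x -> T y ->
    near d (x 0) (y 0) -> near e (x t) (y t);
  sm_limit : forall x p, T x -> Om x p -> exists y, T y /\ y 0 = p }.

Lemma cluster_real (P : R -> R -> Prop) (f : R -> R) (B : R) :
  (forall e e' s, e <= e' -> P e s -> P e' s) ->
  (forall e s, P e s -> Rabs (f s) <= B) ->
  (forall e T0, 0 < e -> exists s, T0 <= s /\ P e s) ->
  exists l, forall e T0, 0 < e -> exists s, T0 <= s /\ P e s /\ Rabs (f s - l) < e.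
Proof.
  intros Pm Pb Pf.
  pose (E := fun c => forall e T0, 0 < e -> exists s, T0 <= s /\ P e s /\ c <= f s).
  destruct (completeness E) as (l & Hub & Hlub).
  - exists B; intros c Hc; destruct (Hc 1 0) as (s & _ & Ps & Hs); [lra|].
    specialize (Pb _ _ Ps); pose proof (Rle_abs (f s)); lra.
  - exists (- B); intros e T0 He; destruct (Pf e T0 He) as (s & Hs & Ps).
    exists s; repeat split; try assumption.
    specialize (Pb _ _ Ps); pose proof (Rle_abs (- f s)) as Hn; rewrite Rabs_Ropp in Hn; lra.
  - exists l; intros e T0 He.
    assert (Hc : exists c, E c /\ l - e < c).
    { apply NNPP; intro Hn; assert (l <= l - e); [|lra].
      apply Hlub; intros c Hc; apply Rnot_lt_le; intro; apply Hn; exists c; split; assumption. }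
    destruct Hc as (c & Hc & Hlc).
    assert (Hn : ~ E (l + e)) by (intro HE; specialize (Hub _ HE); lra).
    apply not_all_ex_not in Hn; destruct Hn as (e0 & Hn).
    apply not_all_ex_not in Hn; destruct Hn as (T1 & Hn).
    apply imply_to_and in Hn; destruct Hn as (He0 & Hn).
    destruct (Hc (Rmin e e0) (Rmax T0 T1)) as (s & Hs & Ps & Hcs); [apply Rmin_glb_lt; assumption|].
    pose proof (Rmax_l T0 T1); pose proof (Rmax_r T0 T1).
    exists s; split; [lra|]; split; [exact (Pm _ _ _ (Rmin_l e e0) Ps)|].
    apply Rabs_def1; [|lra].
    apply Rnot_le_lt; intro Hge; apply Hn; exists s; repeat split; try lra.
    exact (Pm _ _ _ (Rmin_r e e0) Ps).
Qed.

(* Bolzano-Weierstrass, with a side condition that may tighten as the precision does. *)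
Lemma cluster_point (P : R -> R -> Prop) (x : traj) (B : R) :
  (forall e e' s, e <= e' -> P e s -> P e' s) ->
  (forall s i, 0 <= s -> Rabs (x s i) <= B) ->
  (forall e T0, 0 < e -> exists s, T0 <= s /\ P e s) ->
  exists z, forall e T0, 0 < e -> exists s, T0 <= s /\ 0 <= s /\ P e s /\ near e (x s) z.
Proof.
  intros Pm Hb Pf.
  destruct (cluster_real (fun e s => 0 <= s /\ P e s) (fun s => x s X1) B) as (l1 & H1).
  { intros e e' s He (? & Ps); split; [assumption | exact (Pm _ _ _ He Ps)]. }
  { intros e s (Hs & _); apply Hb; exact Hs. }
  { intros e T0 He; destruct (Pf e (Rmax T0 0) He) as (s & Hs & Ps).
    pose proof (Rmax_l T0 0); pose proof (Rmax_r T0 0).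
    exists s; repeat split; try lra; exact Ps. }
  destruct (cluster_real (fun e s => (0 <= s /\ P e s) /\ Rabs (x s X1 - l1) < e)
              (fun s => x s X2) B) as (l2 & H2).
  { intros e e' s He ((? & Ps) & ?); repeat split; try lra; exact (Pm _ _ _ He Ps). }
  { intros e s ((Hs & _) & _); apply Hb; exact Hs. }
  { exact H1. }
  destruct (cluster_real (fun e s => ((0 <= s /\ P e s) /\ Rabs (x s X1 - l1) < e)
              /\ Rabs (x s X2 - l2) < e) (fun s => x s X3) B) as (l3 & H3).
  { intros e e' s He (((? & Ps) & ?) & ?); repeat split; try lra; exact (Pm _ _ _ He Ps). }
  { intros e s (((Hs & _) & _) & _); apply Hb; exact Hs. }
  { exact H2. }
  destruct (cluster_real (fun e s => (((0 <= s /\ P e s) /\ Rabs (x s X1 - l1) < e)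
              /\ Rabs (x s X2 - l2) < e) /\ Rabs (x s X3 - l3) < e) (fun s => x s X4) B) as (l4 & H4).
  { intros e e' s He ((((? & Ps) & ?) & ?) & ?); repeat split; try lra; exact (Pm _ _ _ He Ps). }
  { intros e s ((((Hs & _) & _) & _) & _); apply Hb; exact Hs. }
  { exact H3. }
  exists (fun i => match i with X1 => l1 | X2 => l2 | X3 => l3 | X4 => l4 end).
  intros e T0 He; destruct (H4 e T0 He) as (s & Hs & ((((Hs0 & Ps) & ?) & ?) & ?) & ?).
  exists s; repeat split; try assumption.
  intros [| | |]; assumption.
Qed.

Section LimitSets.
Variable T : traj -> Prop.
Hypothesis SM : strongly_monotone T.

Let bounded := sm_bounded T SM.
Let mono := sm_mono T SM.
Let strong := sm_strong T SM.

Lemma T_cluster (P : R -> R -> Prop) x : T x ->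
  (forall e e' s, e <= e' -> P e s -> P e' s) ->
  (forall e T0, 0 < e -> exists s, T0 <= s /\ P e s) ->
  exists z, forall e T0, 0 < e -> exists s, T0 <= s /\ 0 <= s /\ P e s /\ near e (x s) z.
Proof.
  intros Tx Pm Pf; destruct bounded as (B & HB).
  apply (cluster_point P x B); auto.
Qed.

Lemma mono_from x y s t h : T x -> T y -> 0 <= s -> 0 <= t -> 0 <= h ->
  vle (x s) (y t) -> vle (x (s + h)) (y (t + h)).
Proof.
  intros Tx Ty Hs Ht Hh H.
  apply (mono (shift s x) (shift t y)); try (apply (sm_shift T SM); assumption); try assumption.
  unfold shift; rewrite !Rplus_0_r; exact H.
Qed.

Lemma Om_nonempty x : T x -> exists z, Om x z.
Proof.
  intro Tx; destruct (T_cluster (fun _ _ => True) x Tx) as (z & Hz).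
  - tauto.
  - intros e T0 _; exists T0; split; [lra | trivial].
  - exists z; intros e T0 He; destruct (Hz e T0 He) as (s & ? & ? & _ & ?); exists s; auto.
Qed.

Lemma Om2_l x y a b : Om2 x y a b -> Om x a.
Proof. intros H e T0 He; destruct (H e T0 He) as (t & ? & ? & ? & ?); exists t; auto. Qed.

Lemma Om2_r x y a b : Om2 x y a b -> Om y b.
Proof. intros H e T0 He; destruct (H e T0 He) as (t & ? & ? & ? & ?); exists t; auto. Qed.

Lemma Om2_complete x y b : T x -> Om y b -> exists a, Om2 x y a b.
Proof.
  intros Tx Hb.
  destruct (T_cluster (fun e s => near e (y s) b) x Tx) as (a & Ha).
  - intros e e' s He; apply near_weaken, He.
  - intros e T0 He; destruct (Hb e T0 He) as (t & ? & ? & ?); exists t; auto.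
  - exists a; intros e T0 He; destruct (Ha e T0 He) as (s & ? & ? & ? & ?); exists s; auto.
Qed.

Lemma near_from e t : 0 <= t -> 0 < e -> exists d, 0 < d /\ forall x y s, T x -> T y -> 0 <= s ->
  near d (x s) (y 0) -> near e (x (s + t)) (y t).
Proof.
  intros Ht He; destruct (sm_dep T SM t e Ht He) as (d & Hd & H).
  exists d; split; [exact Hd|]; intros x y s Tx Ty Hs Hn.
  apply (H (shift s x) y); [apply (sm_shift T SM)| |unfold shift; rewrite Rplus_0_r]; assumption.
Qed.

Lemma Om2_flow x y al be t : T x -> T y -> T al -> T be ->
  Om2 x y (al 0) (be 0) -> 0 <= t -> Om2 x y (al t) (be t).
Proof.
  intros Tx Ty Ta Tb H Ht e T0 He.
  destruct (near_from e t Ht He) as (d & Hd & Hn).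
  destruct (H d T0 Hd) as (s & Hs & Hs0 & Ha & Hb).
  exists (s + t); repeat split; try lra; apply Hn; assumption.
Qed.

Lemma Om_flow x al t : T x -> T al -> Om x (al 0) -> 0 <= t -> Om x (al t).
Proof.
  intros Tx Ta H Ht; apply (Om2_l x x _ (al t)), (Om2_flow x x al al t); auto.
  intros e T0 He; destruct (H e T0 He) as (s & ? & ? & ?); exists s; auto.
Qed.

Lemma Om_closed x z : (forall e, 0 < e -> exists z', near e z' z /\ Om x z') -> Om x z.
Proof.
  intros H e T0 He; destruct (H (e / 2)) as (z' & Hz & Ho); [lra|].
  destruct (Ho (e / 2) T0) as (t & Ht & Ht0 & Hn); [lra|].
  exists t; repeat split; auto.
  replace e with (e / 2 + e / 2) by field; eapply near_trans; eassumption.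
Qed.

Lemma Om_Om x al z : T x -> T al -> Om x (al 0) -> Om al z -> Om x z.
Proof.
  intros Tx Ta H Hz; apply Om_closed; intros e He.
  destruct (Hz e 0 He) as (t & _ & Ht & Hn).
  exists (al t); split; [exact Hn | apply Om_flow; assumption].
Qed.

Lemma Om_backward x z t : T x -> Om x z -> 0 <= t ->
  exists al, T al /\ Om x (al 0) /\ al t = z.
Proof.
  intros Tx Hz Ht.
  destruct (Om2_complete x (shift t x) z Tx) as (a & Ha).
  { intros e T0 He; destruct (Hz e (t + Rmax T0 0) He) as (s & Hs & Hs0 & Hn).
    pose proof (Rmax_l T0 0); pose proof (Rmax_r T0 0).
    exists (s - t); repeat split; try lra.
    unfold shift; replace (t + (s - t)) with s by ring; exact Hn. }
  destruct (sm_limit T SM x a Tx (Om2_l _ _ _ _ Ha)) as (al & Tal & <-).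
  exists al; repeat split; [exact Tal | exact (Om2_l _ _ _ _ Ha) |].
  apply near_eq; intros e He.
  destruct (near_from (e / 2) t Ht) as (d & Hd & Hn); [lra|].
  destruct (Ha (Rmin d (e / 2)) 0) as (s & _ & Hs & H1 & H2); [apply Rmin_glb_lt; lra|].
  replace e with (e / 2 + e / 2) by field; apply near_trans with (x (s + t)).
  - apply near_sym, Hn; auto; eapply near_weaken; [apply Rmin_l | exact H1].
  - unfold shift in H2; rewrite (Rplus_comm t s) in H2.
    eapply near_weaken; [apply Rmin_r | exact H2].
Qed.

(* Hirsch: after moving [s] to the last time at which [x] lies below [x s], any point of
   [(s, b]] below [x s] is excluded; but reducing the fall length [h] modulo the rise length
   [b - s] yields one. *)
Lemma no_fall_then_rise x a h s b : T x -> 0 <= a <= s -> 0 < h -> vle (x (a + h)) (x a) ->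
  s < b -> vle (x s) (x b) -> x s <> x b -> False.
Proof.
  intros Tx Ha Hh Hfall Hsb Hrise Hne.
  pose (E := fun t => s <= t <= b /\ vle (x t) (x s)).
  destruct (completeness E) as (m & Hub & Hlub).
  { exists b; intros t (Ht & _); lra. }
  { exists s; split; [lra | apply vle_refl]. }
  assert (Hsm : s <= m) by (apply Hub; split; [lra | apply vle_refl]).
  assert (Hmb : m <= b) by (apply Hlub; intros t (Ht & _); lra).
  assert (Hm : vle (x m) (x s)).
  { apply vle_closed; intros e He.
    destruct (sm_ucont T SM e He) as (d & Hd & Hc).
    assert (Ht : exists t, E t /\ m - d < t).
    { apply NNPP; intro Hn; assert (m <= m - d); [|lra].
      apply Hlub; intros t Ht; apply Rnot_lt_le; intro; apply Hn; exists t; auto. }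
    destruct Ht as (t & (Ht & Hle) & Hmt).
    assert (t <= m) by (apply Hub; split; assumption).
    exists (x t), (x s); repeat split; [|apply near_refl, He|exact Hle].
    apply Hc; auto; try lra; apply Rabs_le; lra. }
  assert (Hmb' : m < b).
  { destruct (Rle_lt_or_eq_dec _ _ Hmb) as [| ->]; [assumption|].
    exfalso; apply Hne, vle_antisym; assumption. }
  assert (Hno : forall t, m < t <= b -> vle (x t) (x m) -> False).
  { intros t Ht Hle; assert (t <= m); [|lra].
    apply Hub; split; [lra | exact (vle_trans _ _ _ Hle Hm)]. }
  assert (Hf : vle (x (m + h)) (x m)).
  { replace (m + h) with (a + h + (m - a)) by ring; replace (x m) with (x (a + (m - a))).
    - apply mono_from; auto; lra.
    - f_equal; ring. }
  set (k := b - m); assert (Hk : 0 < k) by (unfold k; lra).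
  assert (Hr : forall t, m <= t -> vle (x t) (x (t + k))).
  { intros t Ht; replace (x t) with (x (m + (t - m))) by (f_equal; ring).
    replace (t + k) with (b + (t - m)) by (unfold k; ring).
    apply mono_from; auto; try lra; exact (vle_trans _ _ _ Hm Hrise). }
  assert (Hrn : forall n t, m <= t -> vle (x t) (x (t + INR n * k))).
  { induction n as [|n IH]; intros t Ht.
    - simpl; rewrite Rmult_0_l, Rplus_0_r; apply vle_refl.
    - rewrite S_INR; apply vle_trans with (x (t + k)); [apply Hr, Ht|].
      replace (t + (INR n + 1) * k) with (t + k + INR n * k) by ring; apply IH; lra. }
  assert (Hn : exists n, 0 < h - INR n * k <= k).
  { assert (Hd : forall n, h <= INR (S n) * k -> exists n, 0 < h - INR n * k <= k).
    { induction n as [|n IH]; intro H.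
      - exists 0%nat; simpl in *; lra.
      - destruct (Rle_lt_dec h (INR (S n) * k)); [apply IH; assumption|].
        exists (S n); rewrite (S_INR (S n)) in H; lra. }
    destruct (INR_archimed k h Hk) as (n & Hn); apply (Hd n); rewrite S_INR; nra. }
  destruct Hn as (n & Hn).
  apply (Hno (m + (h - INR n * k))); [unfold k in *; lra|].
  apply vle_trans with (x (m + h)); [|exact Hf].
  replace (m + h) with (m + (h - INR n * k) + INR n * k) by ring.
  apply Hrn; lra.
Qed.

Lemma Om_unordered x p q : T x -> Om x p -> Om x q -> vle p q -> p = q.
Proof.
  intros Tx Hp Hq Hle; apply NNPP; intro Hne.
  destruct (sm_limit T SM x p Tx Hp) as (al & Ta & <-).
  destruct (sm_limit T SM x q Tx Hq) as (be & Tb & <-).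
  assert (Hll : vll (al 1) (be 1)) by (apply strong; auto; lra).
  apply (Om_flow x al 1) in Hp; auto; try lra.
  apply (Om_flow x be 1) in Hq; auto; try lra.
  destruct (vll_margin _ _ Hll) as (e & He & Hm).
  destruct (Hq e 0 He) as (s1 & _ & Hs1 & N1).
  destruct (Hp e (s1 + 1) He) as (s2 & Hs2 & _ & N2).
  destruct (Hq e (s2 + 1) He) as (s3 & Hs3 & _ & N3).
  apply (no_fall_then_rise x s1 (s2 - s1) s2 s3); auto; try lra.
  - replace (s1 + (s2 - s1)) with s2 by ring; apply vll_vle, Hm; assumption.
  - apply vll_vle, Hm; assumption.
  - apply vll_neq, Hm; assumption.
Qed.

Lemma Om2_le x y a b : T x -> T y -> vle (x 0) (y 0) -> Om2 x y a b -> vle a b.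
Proof.
  intros Tx Ty Hle H; apply vle_closed; intros e He.
  destruct (H e 0 He) as (t & _ & Ht & Ha & Hb).
  exists (x t), (y t); repeat split; auto.
Qed.

Lemma Om2_le_delayed x y al b h t0 : T x -> T y -> T al -> Om2 x y (al 0) b -> 0 <= h ->
  (forall t, t0 <= t -> 0 <= t -> vle (x (t + h)) (y t)) -> vle (al h) b.
Proof.
  intros Tx Ty Ta Ho Hh H; apply vle_closed; intros e He.
  destruct (near_from e h Hh He) as (d & Hd & Hn).
  destruct (Ho (Rmin d e) t0) as (s & Hs & Hs0 & N1 & N2); [apply Rmin_glb_lt; assumption|].
  exists (x (s + h)), (y s); repeat split; auto.
  - apply Hn; auto; eapply near_weaken; [apply Rmin_l | exact N1].
  - eapply near_weaken; [apply Rmin_r | exact N2].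
Qed.

Lemma colimit_orbit_below x y al b : T x -> T y -> T al -> vle (x 0) (y 0) ->
  Om2 x y (al 0) b -> al 0 <> b -> forall h, 0 <= h -> vle (al h) b.
Proof.
  intros Tx Ty Ta Hle Ho Hne.
  assert (Hab : vle (al 0) b) by exact (Om2_le x y _ _ Tx Ty Hle Ho).
  destruct (sm_limit T SM y b Ty (Om2_r _ _ _ _ Ho)) as (be & Tb & Eb).
  apply (real_induction (fun h => vle (al h) b)).
  - exact Hab.
  - intros h Hh H; apply vle_closed; intros e He.
    destruct (sm_ucont T SM e He) as (d & Hd & Hc).
    pose proof (Rmin_l d h); pose proof (Rmin_r d h).
    assert (0 < Rmin d h) by (apply Rmin_glb_lt; assumption).
    exists (al (h - Rmin d h)), b; repeat split; [|apply near_refl, He | apply H; lra].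
    apply Hc; auto; try lra; apply Rabs_le; lra.
  - intros h Hh H.
    assert (Hn : al h <> b).
    { intro E; apply Hne; apply (Om_unordered x); auto; [exact (Om2_l _ _ _ _ Ho)|].
      rewrite <- E; apply Om_flow; auto; exact (Om2_l _ _ _ _ Ho). }
    assert (Hll : vll (al (h + 1)) (be 1)).
    { assert (S : vll (shift h al 1) (be 1)); [|exact S].
      apply strong; auto; try lra.
      - apply (sm_shift T SM); assumption.
      - unfold shift; rewrite Rplus_0_r, Eb; apply H; lra.
      - unfold shift; rewrite Rplus_0_r, Eb; exact Hn. }
    destruct (vll_margin _ _ Hll) as (e & He & Hm).
    destruct (sm_ucont T SM (e / 2)) as (d & Hd & Hc); [lra|].
    exists d; split; [exact Hd|]; intros h' Hh'.
    destruct (near_from (e / 2) (h + 1)) as (d1 & Hd1 & N1); [lra|lra|].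
    destruct (near_from (e / 2) 1) as (d2 & Hd2 & N2); [lra|lra|].
    destruct (Ho (Rmin d1 d2) 0) as (s & _ & Hs & M1 & M2); [apply Rmin_glb_lt; assumption|].
    apply (Om2_le_delayed x y al b h' (s + 1)); auto; try lra.
    intros t Ht Ht0.
    replace (t + h') with (s + h' + 1 + (t - (s + 1))) by ring.
    replace (y t) with (y (s + 1 + (t - (s + 1)))) by (f_equal; ring).
    apply mono_from; auto; try lra.
    apply vll_vle, Hm.
    + replace e with (e / 2 + e / 2) by field; apply near_trans with (x (s + (h + 1))).
      * apply Hc; auto; try lra; apply Rabs_le; lra.
      * apply N1; auto; eapply near_weaken; [apply Rmin_l | exact M1].
    + apply near_weaken with (e / 2); [lra|].
      apply N2; auto; rewrite Eb; eapply near_weaken; [apply Rmin_r | exact M2].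
Qed.

(* Hirsch's colimiting principle. *)
Lemma colimit_stationary x y al : T x -> T y -> T al -> vll (x 0) (y 0) ->
  Om2 x y (al 0) (al 0) -> exists e, 0 < e /\ forall h, 0 <= h <= e -> al h = al 0.
Proof.
  intros Tx Ty Ta Hll Ho.
  destruct (vll_margin _ _ Hll) as (e & He & Hm).
  destruct (sm_ucont T SM e He) as (d & Hd & Hc).
  exists d; split; [exact Hd|]; intros h Hh.
  assert (Hx : near e (x h) (x 0)) by (apply Hc; auto; try lra; apply Rabs_le; lra).
  assert (Hy : near e (y h) (y 0)) by (apply Hc; auto; try lra; apply Rabs_le; lra).
  apply vle_antisym.
  - apply (Om2_le_delayed x y al (al 0) h 0); auto; try lra.
    intros t _ Ht; replace (t + h) with (h + t) by ring.
    replace (y t) with (y (0 + t)) by (f_equal; ring).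
    apply mono_from; auto; try lra; apply vll_vle, Hm; auto; apply near_refl, He.
  - apply vle_closed; intros e1 He1.
    destruct (near_from e1 h) as (d1 & Hd1 & Hn); [lra|lra|].
    destruct (Ho (Rmin d1 e1) 0) as (s & _ & Hs & N1 & N2); [apply Rmin_glb_lt; assumption|].
    exists (x s), (y (s + h)); repeat split.
    + eapply near_weaken; [apply Rmin_r | exact N1].
    + apply Hn; auto; eapply near_weaken; [apply Rmin_l | exact N2].
    + replace (x s) with (x (0 + s)) by (f_equal; ring).
      replace (s + h) with (h + s) by ring.
      apply mono_from; auto; try lra; apply vll_vle, Hm; auto; apply near_refl, He.
Qed.

Definition dle (up : bool) (u v : V) := if up then vle u v else vle v u.

Lemma dle_closed up u v :
  (forall e, 0 < e -> exists u' v', near e u' u /\ near e v' v /\ dle up u' v') -> dle up u v.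
Proof.
  destruct up; simpl; intro H; apply vle_closed; intros e He; [exact (H e He)|].
  destruct (H e He) as (u' & v' & ? & ? & ?); exists v', u'; auto.
Qed.

Lemma absorption up al y b : T al -> T y -> Om y b -> (forall z, Om al z -> dle up z b) ->
  ~ Om al b -> forall z q, Om al z -> Om y q -> dle up z q.
Proof.
  intros Ta Ty Hb Hle Hnb.
  destruct (sm_limit T SM y b Ty Hb) as (be & Tb & Eb).
  assert (Hclaim : exists e T0, 0 < e /\
    forall s u, T0 <= s -> 0 <= s -> near e u (be 1) -> dle up (al s) u).
  { apply NNPP; intro Hn.
    destruct (T_cluster (fun e s => exists u, 0 <= s /\ near e u (be 1) /\ ~ dle up (al s) u) al Ta)
      as (z & Hz).
    - intros e e' s He (u & Hs & Hu & Hnu); exists u; repeat split; auto.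
      exact (near_weaken _ _ _ _ He Hu).
    - intros e T0 He; apply NNPP; intro Hn'; apply Hn; exists e, T0; split; [exact He|].
      intros s u HsT Hs Hu; apply NNPP; intro Hnu; apply Hn'; exists s; split; auto.
      exists u; auto.
    - assert (Hoz : Om al z).
      { intros e T0 He; destruct (Hz e T0 He) as (s & ? & ? & _ & ?); exists s; auto. }
      destruct (Om_backward al z 1 Ta Hoz) as (ze & Tz & Hz0 & <-); [lra|].
      assert (Hne : ze 0 <> be 0).
      { rewrite Eb; intro E; apply Hnb; rewrite <- E; exact Hz0. }
      specialize (Hle _ Hz0); rewrite <- Eb in Hle.
      destruct up; simpl in *.
      + destruct (vll_margin (ze 1) (be 1)) as (e & He & Hm); [apply strong; auto; lra|].
        destruct (Hz e 0 He) as (s & _ & _ & (u & _ & Hu & Hnu) & Hs).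
        apply Hnu, vll_vle, Hm; assumption.
      + destruct (vll_margin (be 1) (ze 1)) as (e & He & Hm); [apply strong; auto; lra|].
        destruct (Hz e 0 He) as (s & _ & _ & (u & _ & Hu & Hnu) & Hs).
        apply Hnu, vll_vle, Hm; assumption. }
  destruct Hclaim as (e & T0 & He & Hcl).
  assert (Hb1 : Om y (be 1)) by (apply Om_flow; auto; [rewrite Eb; exact Hb | lra]).
  destruct (Hb1 e 0 He) as (tau & _ & Htau & Hnt).
  assert (Hall : forall s t, T0 <= s -> 0 <= s -> 0 <= t -> dle up (al (s + t)) (y (tau + t))).
  { intros s t Hs Hs0 Ht; specialize (Hcl s _ Hs Hs0 Hnt).
    destruct up; apply mono_from; auto. }
  intros z q Hz Hq; apply dle_closed; intros e1 He1.
  destruct (Hq e1 tau He1) as (t & Ht & _ & Nt).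
  destruct (Hz e1 (Rmax T0 0 + (t - tau)) He1) as (s & Hs & _ & Ns).
  pose proof (Rmax_l T0 0); pose proof (Rmax_r T0 0).
  exists (al s), (y t); repeat split; auto.
  replace s with (s - (t - tau) + (t - tau)) by ring.
  replace (y t) with (y (tau + (t - tau))) by (f_equal; ring).
  apply Hall; lra.
Qed.

Lemma colimit_separation x y a b : T x -> T y -> vle (x 0) (y 0) -> Om2 x y a b -> a <> b ->
  (exists e, forall q, Om y q -> q = e) \/ (forall p q, Om x p -> Om y q -> vle p q).
Proof.
  intros Tx Ty Hle Ho Hne.
  pose proof (Om2_l _ _ _ _ Ho) as Hxa.
  destruct (sm_limit T SM x a Tx Hxa) as (al & Ta & <-).
  assert (Hzb : forall z, Om al z -> vle z b).
  { intros z Hz; apply vle_closed; intros e He.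
    destruct (Hz e 0 He) as (t & _ & Ht & Nt).
    exists (al t), b; repeat split; [exact Nt | apply near_refl, He |].
    apply (colimit_orbit_below x y); auto. }
  assert (Hnb : ~ Om al b).
  { intro Hb; apply Hne, (Om_unordered x); auto; [exact (Om_Om x al b Tx Ta Hxa Hb)|].
    exact (Om2_le x y _ _ Tx Ty Hle Ho). }
  pose proof (absorption true al y b Ta Ty (Om2_r _ _ _ _ Ho) Hzb Hnb) as Habs; simpl in Habs.
  destruct (Om_nonempty al Ta) as (z & Hz).
  destruct (classic (Om y z)) as [Hyz | Hyz].
  - left; exists z; intros q Hq; symmetry; apply (Om_unordered y); auto.
  - right; intros p q Hp Hq.
    apply (absorption false y x z Ty Tx (Om_Om x al z Tx Ta Hxa Hz)); auto.
    intros w Hw; apply Habs; assumption.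
Qed.

Definition stationary_point (p : V) : Prop :=
  exists al e, T al /\ al 0 = p /\ 0 < e /\ forall h, 0 <= h <= e -> al h = p.

Theorem limit_set_dichotomy x y : T x -> T y -> vll (x 0) (y 0) ->
  (exists e, forall q, Om y q -> q = e) \/ (forall p q, Om x p -> Om y q -> vle p q) \/
  (forall q, Om y q -> stationary_point q).
Proof.
  intros Tx Ty Hll.
  destruct (classic (exists a b, Om2 x y a b /\ a <> b)) as [(a & b & Ho & Hne) | Hn].
  - destruct (colimit_separation x y a b Tx Ty (vll_vle _ _ Hll) Ho Hne); auto.
  - right; right; intros q Hq.
    destruct (Om2_complete x y q Tx Hq) as (a & Ha).
    assert (E : a = q) by (apply NNPP; intro; apply Hn; exists a, q; auto).
    subst a; destruct (sm_limit T SM y q Ty Hq) as (al & Ta & <-).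
    destruct (colimit_stationary x y al Tx Ty Ta Hll Ha) as (e & He & Hst).
    exists al, e; auto.
Qed.

Lemma Om_unique_converges x e : T x -> (forall q, Om x q -> q = e) ->
  forall r, 0 < r -> exists T0, forall t, T0 <= t -> 0 <= t -> near r (x t) e.
Proof.
  intros Tx Hu r Hr; apply NNPP; intro Hn.
  destruct (T_cluster (fun _ s => 0 <= s /\ ~ near r (x s) e) x Tx) as (z & Hz).
  - auto.
  - intros e0 T0 _; apply NNPP; intro Hn'; apply Hn; exists T0; intros t Ht Ht0.
    apply NNPP; intro; apply Hn'; exists t; auto.
  - assert (Ho : Om x z).
    { intros e0 T0 He; destruct (Hz e0 T0 He) as (s & ? & ? & _ & ?); exists s; auto. }
    rewrite (Hu z Ho) in Hz.
    destruct (Hz r 0 Hr) as (s & _ & _ & (_ & Hns) & Hs); exact (Hns Hs).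
Qed.

(* If two open sets separate [Om x], shrinking them to unions of balls makes them disjoint,
   and the path [x] would eventually have to jump from one to the other. *)
Lemma Om_connected x (U W : V -> Prop) : T x ->
  (forall p, U p -> exists r, 0 < r /\ forall q, near r p q -> U q) ->
  (forall p, W p -> exists r, 0 < r /\ forall q, near r p q -> W q) ->
  (forall p, Om x p -> U p \/ W p) -> (forall p, Om x p -> U p -> W p -> False) ->
  forall p q, Om x p -> Om x q -> U p -> W q -> False.
Proof.
  intros Tx HU HW Hcov Hdis p q Hp Hq Up Wq.
  pose (sh := fun (A : V -> Prop) z => exists c r, Om x c /\ 0 < r /\
     (forall w, near (2 * r) c w -> A w) /\ near r c z).
  assert (Hsh : forall A, (forall p, A p -> exists r, 0 < r /\ forall q, near r p q -> A q) ->
     forall c, Om x c -> A c -> exists r, 0 < r /\ forall z, near r c z -> sh A z).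
  { intros A HA c Hc Ac; destruct (HA c Ac) as (r & Hr & Hrr).
    exists (r / 2); split; [lra|]; intros z Hz; exists c, (r / 2); repeat split; auto; [lra|].
    intros w Hw; apply Hrr; replace r with (2 * (r / 2)) by field; exact Hw. }
  assert (Hshdis : forall z, sh U z -> sh W z -> False).
  { intros z (c & r & Hc & Hr & HcU & Hcz) (c' & r' & Hc' & Hr' & HcW & Hcz').
    assert (Hcc : near (r + r') c c') by (eapply near_trans; [exact Hcz | apply near_sym, Hcz']).
    destruct (Rle_lt_dec r r').
    - apply (Hdis c Hc); [apply HcU, near_refl; lra|].
      apply HcW, near_sym; eapply near_weaken; [|exact Hcc]; lra.
    - apply (Hdis c' Hc'); [|apply HcW, near_refl; lra].
      apply HcU; eapply near_weaken; [|exact Hcc]; lra. }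
  assert (Hev : exists T0, 0 <= T0 /\ forall t, T0 <= t -> sh U (x t) \/ sh W (x t)).
  { apply NNPP; intro Hn.
    destruct (T_cluster (fun _ s => ~ (sh U (x s) \/ sh W (x s))) x Tx) as (z & Hz).
    - auto.
    - intros e T0 _; apply NNPP; intro Hn'; apply Hn; exists (Rmax T0 0).
      split; [apply Rmax_r|]; intros t Ht; apply NNPP; intro H; apply Hn'; exists t.
      split; auto; pose proof (Rmax_l T0 0); lra.
    - assert (Ho : Om x z).
      { intros e0 T0 He; destruct (Hz e0 T0 He) as (s & ? & ? & _ & ?); exists s; auto. }
      destruct (Hcov z Ho) as [Hz1 | Hz1].
      + destruct (Hsh U HU z Ho Hz1) as (r & Hr & Hrr).
        destruct (Hz r 0 Hr) as (s & _ & _ & Hns & Hs); apply Hns; left; apply Hrr, near_sym, Hs.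
      + destruct (Hsh W HW z Ho Hz1) as (r & Hr & Hrr).
        destruct (Hz r 0 Hr) as (s & _ & _ & Hns & Hs); apply Hns; right; apply Hrr, near_sym, Hs. }
  destruct Hev as (T0 & HT0 & Hev).
  assert (Hopen : forall A z, sh A z -> exists r, 0 < r /\ forall w, near r z w -> sh A w).
  { intros A z (c & r & Hc & Hr & HcA & Hcz).
    destruct (ix_uniform (fun i e => Rabs (c i - z i) + e <= r)) as (e & He & Hi).
    - intros i e e' He H; lra.
    - intro i; exists (r - Rabs (c i - z i)); specialize (Hcz i); split; lra.
    - exists e; split; [exact He|]; intros w Hw; exists c, r; repeat split; auto.
      intro i; specialize (Hi i); specialize (Hw i).
      replace (c i - w i) with ((c i - z i) + (z i - w i)) by ring.
      eapply Rle_lt_trans; [apply Rabs_triang | lra]. }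
  assert (Hstep : forall A t, 0 <= t -> sh A (x t) ->
     exists d, 0 < d /\ forall t', 0 <= t' -> Rabs (t' - t) <= d -> sh A (x t')).
  { intros A t Ht HA; destruct (Hopen A _ HA) as (r & Hr & Hrr).
    destruct (sm_ucont T SM r Hr) as (d & Hd & Hc).
    exists d; split; [exact Hd|]; intros t' Ht' Htt; apply Hrr, near_sym, Hc; auto. }
  destruct (Hsh U HU p Hp Up) as (r & Hr & Hrr).
  destruct (Hp r T0 Hr) as (t1 & Ht1 & Ht1' & N1).
  apply near_sym, Hrr in N1.
  destruct (Hsh W HW q Hq Wq) as (r' & Hr' & Hrr').
  destruct (Hq r' t1 Hr') as (t2 & Ht2 & Ht2' & N2).
  apply near_sym, Hrr' in N2.
  assert (HUall : forall h, 0 <= h -> sh U (x (t1 + h))).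
  { apply (real_induction (fun h => sh U (x (t1 + h)))).
    - rewrite Rplus_0_r; exact N1.
    - intros h Hh H; destruct (Hev (t1 + h)) as [|HWh]; [lra | assumption |].
      destruct (Hstep W (t1 + h)) as (d & Hd & Hdd); [lra | exact HWh |].
      pose proof (Rmin_l d h); pose proof (Rmin_r d h).
      assert (0 < Rmin d h) by (apply Rmin_glb_lt; assumption).
      exfalso; apply (Hshdis (x (t1 + (h - Rmin d h)))); [apply H; lra|].
      apply Hdd; [lra|]; apply Rabs_le; lra.
    - intros h Hh H; destruct (Hstep U (t1 + h)) as (d & Hd & Hdd); [lra | apply H; lra |].
      exists d; split; [exact Hd|]; intros h' Hh'; apply Hdd; [lra|]; apply Rabs_le; lra. }
  apply (Hshdis (x t2)); [|exact N2].
  replace t2 with (t1 + (t2 - t1)) by ring; apply HUall; lra.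
Qed.

End LimitSets.

(** * Cooperative differential equations *)

Definition sum4 (f : ix -> R) : R := f X1 + f X2 + f X3 + f X4.

Lemma sum4_abs_le f b : (forall j, Rabs (f j) <= b) -> Rabs (sum4 f) <= 4 * b.
Proof.
  intro H; unfold sum4.
  pose proof (H X1) as H1; pose proof (H X2) as H2; pose proof (H X3) as H3; pose proof (H X4) as H4.
  pose proof (Rabs_triang (f X1 + f X2 + f X3) (f X4)).
  pose proof (Rabs_triang (f X1 + f X2) (f X3)).
  pose proof (Rabs_triang (f X1) (f X2)); lra.
Qed.

Lemma mean_value f a b : a < b -> (forall t, continuity_pt f t) ->
  (forall t, a < t < b -> exists l, derivable_pt_lim f t l) ->
  exists c l, a < c < b /\ derivable_pt_lim f c l /\ f b - f a = l * (b - a).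
Proof.
  intros Hab Hc Hd.
  assert (pr1 : forall c, a < c < b -> derivable_pt f c).
  { intros c H; destruct (constructive_indefinite_description _ (Hd c H)) as (l & Hl).
    exists l; exact Hl. }
  assert (pr2 : forall c, a < c < b -> derivable_pt id c) by (intros; apply derivable_pt_id).
  destruct (MVT f id a b pr1 pr2 Hab) as (c & Hc' & E).
  - intros; apply Hc.
  - intros; apply derivable_continuous_pt, derivable_pt_id.
  - exists c, (derive_pt f c (pr1 c Hc')); split; [exact Hc'|]; split.
    + apply (derive_pt_eq f c _ (pr1 c Hc')); reflexivity.
    + rewrite (derive_pt_eq_0 id c 1 (pr2 c Hc') (derivable_pt_lim_id c)) in E.
      unfold id in E; lra.
Qed.

Lemma cont_positive_nearby f t : continuity_pt f t -> 0 < f t ->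
  exists d, 0 < d /\ forall s, Rabs (s - t) <= d -> 0 < f s.
Proof.
  intros Hc Hp; destruct (Hc (f t) Hp) as (d & Hd & H).
  exists (d / 2); split; [lra|]; intros s Hs.
  destruct (Req_dec s t) as [-> | Hne]; [exact Hp|].
  specialize (H s); simpl in H; unfold Rdist in H.
  assert (Hs' : Rabs (f s - f t) < f t).
  { apply H; split; [split; [exact I | auto] | lra]. }
  apply Rabs_def2 in Hs'; lra.
Qed.

Lemma cont_nonneg_left f h : continuity_pt f h -> 0 < h -> (forall s, 0 <= s < h -> 0 < f s) -> 0 <= f h.
Proof.
  intros Hc Hh H; apply Rnot_lt_le; intro Hn.
  destruct (cont_positive_nearby (- f)%F h) as (d & Hd & Hs).
  - apply continuity_pt_opp, Hc.
  - unfold opp_fct; lra.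
  - pose proof (Rmin_l d h); pose proof (Rmin_r d h).
    assert (0 < Rmin d h) by (apply Rmin_glb_lt; assumption).
    specialize (Hs (h - Rmin d h)); unfold opp_fct in Hs.
    specialize (H (h - Rmin d h)).
    assert (0 < - f (h - Rmin d h)) by (apply Hs, Rabs_le; lra).
    assert (0 < f (h - Rmin d h)) by (apply H; lra); lra.
Qed.

Lemma derive_positive_left f h l : derivable_pt_lim f h l -> 0 < l -> 0 < h -> f h <= 0 ->
  exists s, 0 <= s < h /\ f s < 0.
Proof.
  intros Hd Hl Hh Hf; destruct (Hd l Hl) as ((d & Hdp) & H); simpl in H.
  pose proof (Rmin_l (d / 2) h); pose proof (Rmin_r (d / 2) h).
  assert (Hm : 0 < Rmin (d / 2) h) by (apply Rmin_glb_lt; lra).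
  set (k := Rmin (d / 2) h) in *.
  exists (h - k); split; [lra|].
  assert (Hk : Rabs ((f (h + - k) - f h) / - k - l) < l).
  { apply H; [lra|]; rewrite Rabs_Ropp, Rabs_pos_eq; lra. }
  apply Rabs_def2 in Hk; destruct Hk as (_ & Hk).
  assert (Hq : 0 < (f (h + - k) - f h) / - k) by lra.
  assert (Hq2 : f (h + - k) - f h = - ((f (h + - k) - f h) / - k * k)) by (field; lra).
  unfold Rminus at 1; nra.
Qed.

(* [cm_ij] is the influence of coordinate [i] on coordinate [j], i.e. the entry [a j i]; these
   entries form a strongly connected graph. *)
Record coop_matrix (K : R) (a : ix -> ix -> R) : Prop := {
  cm_bound : forall i j, Rabs (a i j) <= K;
  cm_offdiag : forall i j, i <> j -> 0 <= a i j;
  cm_12 : 0 < a X2 X1; cm_24 : 0 < a X4 X2; cm_34 : 0 < a X4 X3;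
  cm_41 : 0 < a X1 X4; cm_43 : 0 < a X3 X4 }.

Definition coop_field (K : R) (D : V -> Prop) (F : V -> V) : Prop :=
  0 <= K /\ forall u v, D u -> D v -> exists a, coop_matrix K a /\
    forall i, F v i - F u i = sum4 (fun j => a i j * (v j - u j)).

Definition coop_linear (K : R) (w : traj) : Prop :=
  0 <= K /\ (forall i t, continuity_pt (fun u => w u i) t) /\
  forall t, 0 < t -> exists a, coop_matrix K a /\
    forall i, derivable_pt_lim (fun u => w u i) t (sum4 (fun j => a i j * w t j)).

(* [- d e^((4K+1)t)] is a strict subsolution: at a first contact the derivative has the wrong sign. *)
Lemma coop_linear_lower K w d : coop_linear K w -> 0 < d -> (forall i, - d < w 0 i) ->
  forall t, 0 <= t -> forall i, - (d * exp ((4 * K + 1) * t)) < w t i.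
Proof.
  intros (HK & Hc & Hw) Hd H0.
  pose (E := fun t => d * exp ((4 * K + 1) * t)).
  assert (HEp : forall t, 0 < E t).
  { intro t; unfold E; apply Rmult_lt_0_compat; [exact Hd | apply exp_pos]. }
  assert (HE' : forall t, derivable_pt_lim E t ((4 * K + 1) * E t)).
  { intro t; unfold E.
    replace ((4 * K + 1) * (d * exp ((4 * K + 1) * t)))
      with (d * (exp ((4 * K + 1) * t) * ((4 * K + 1) * 1))) by ring.
    apply (derivable_pt_lim_scal (fun t => exp ((4 * K + 1) * t))).
    apply (derivable_pt_lim_comp (fun t => (4 * K + 1) * t) exp).
    - apply (derivable_pt_lim_scal id), derivable_pt_lim_id.
    - apply derivable_pt_lim_exp. }
  pose (u := fun i t => w t i + E t).
  assert (Huc : forall i t, continuity_pt (u i) t).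
  { intros i t; apply (continuity_pt_plus (fun t => w t i) E); [apply Hc|].
    apply derivable_continuous_pt; exists ((4 * K + 1) * E t); apply HE'. }
  assert (Hgoal : forall t, 0 <= t -> forall i, 0 < u i t).
  { apply (real_induction (fun t => forall i, 0 < u i t)).
    - intro i; unfold u, E; rewrite Rmult_0_r, exp_0; specialize (H0 i); lra.
    - intros h Hh H.
      assert (Hge : forall j, 0 <= u j h).
      { intro j; apply cont_nonneg_left; auto. }
      intro i; apply Rnot_le_lt; intro Hle.
      destruct (Hw h Hh) as (a & Ha & Hder).
      assert (Hpos : 0 < sum4 (fun j => a i j * w h j) + (4 * K + 1) * E h).
      { assert (Hterm : forall j, - K * E h <= a i j * w h j).
        { intro j; pose proof (cm_bound K a Ha i j) as Hb.
          pose proof (Rle_abs (a i j)) as Hb1.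
          replace (w h j) with (u j h - E h) by (unfold u; ring).
          pose proof (HEp h).
          assert (0 <= a i j * u j h).
          { assert (Hij : i = j \/ i <> j) by apply classic; destruct Hij as [<- | Hij].
            - replace (u i h) with 0 by (specialize (Hge i); lra); lra.
            - apply Rmult_le_pos; [apply (cm_offdiag K a Ha i j Hij) | apply Hge]. }
          nra. }
        unfold sum4; pose proof (Hterm X1); pose proof (Hterm X2);
        pose proof (Hterm X3); pose proof (Hterm X4); pose proof (HEp h); nra. }
      destruct (derive_positive_left (u i) h _
                  (derivable_pt_lim_plus _ _ h _ _ (Hder i) (HE' h)) Hpos Hh Hle) as (s & Hs & Hus).
      specialize (H s Hs i); lra.
    - intros h Hh H.
      destruct (ix_uniform (fun i d => forall s, h <= s <= h + d -> 0 < u i s)) as (d0 & Hd0 & Hi).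
      + intros i e e' He Hs s Hs'; apply Hs; lra.
      + intro i; destruct (cont_positive_nearby (u i) h (Huc i h)) as (d0 & Hd0 & Hs).
        * apply H; lra.
        * exists d0; split; [exact Hd0|]; intros s Hs'; apply Hs, Rabs_le; lra.
      + exists d0; split; [exact Hd0|]; intros s Hs i; apply Hi, Hs. }
  intros t Ht i; specialize (Hgoal t Ht i); unfold u, E in Hgoal; lra.
Qed.

Lemma coop_linear_nonneg K w : coop_linear K w -> (forall i, 0 <= w 0 i) ->
  forall t, 0 <= t -> forall i, 0 <= w t i.
Proof.
  intros Hw H0 t Ht i; apply Rnot_lt_le; intro Hn.
  set (E := exp ((4 * K + 1) * t)); assert (HE : 0 < E) by apply exp_pos.
  assert (Hd : 0 < - w t i / E) by (apply Rdiv_lt_0_compat; lra).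
  assert (H0' : forall j, - (- w t i / E) < w 0 j) by (intro j; specialize (H0 j); lra).
  pose proof (coop_linear_lower K w _ Hw Hd H0' t Ht i) as H; fold E in H.
  replace (- (- w t i / E * E)) with (w t i) in H by (field; lra); lra.
Qed.

Lemma exp_weighted_step K f s t : 0 <= s < t -> (forall r, continuity_pt f r) ->
  (forall r, 0 < r -> exists l, derivable_pt_lim f r l) ->
  exists c l, s < c < t /\ derivable_pt_lim f c l /\
    exp (K * t) * f t - exp (K * s) * f s = exp (K * c) * (l + K * f c) * (t - s).
Proof.
  intros Hst Hc Hd.
  assert (He : forall r, derivable_pt_lim (fun r => exp (K * r)) r (exp (K * r) * (K * 1))).
  { intro r; apply (derivable_pt_lim_comp (fun t => K * t) exp).
    - apply (derivable_pt_lim_scal id), derivable_pt_lim_id.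
    - apply derivable_pt_lim_exp. }
  destruct (mean_value (fun r => exp (K * r) * f r) s t) as (c & l & Hcst & Hl & E).
  - lra.
  - intro r; apply (continuity_pt_mult (fun r => exp (K * r)) f); [|apply Hc].
    apply derivable_continuous_pt; eexists; apply He.
  - intros r Hr; destruct (Hd r) as (l & Hl); [lra|].
    eexists; apply (derivable_pt_lim_mult (fun r => exp (K * r)) f); [apply He | exact Hl].
  - destruct (Hd c) as (l' & Hl'); [lra|].
    exists c, l'; split; [exact Hcst|]; split; [exact Hl'|].
    pose proof (derivable_pt_lim_mult _ f c _ _ (He c) Hl') as Hm.
    rewrite (uniqueness_limite _ _ _ _ Hl Hm) in E; rewrite E; ring.
Qed.

Lemma coop_linear_strong K w : coop_linear K w -> (forall i, 0 <= w 0 i) ->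
  (exists j, 0 < w 0 j) -> forall t, 0 < t -> forall i, 0 < w t i.
Proof.
  intros Hw H0 Hj.
  assert (Hge : forall t, 0 <= t -> forall i, 0 <= w t i) by (apply (coop_linear_nonneg K); auto).
  destruct Hw as (HK & Hc & Hw).
  assert (Hex : forall i r, 0 < r -> exists l, derivable_pt_lim (fun u => w u i) r l).
  { intros i r Hr; destruct (Hw r Hr) as (a & _ & Hd); eexists; apply Hd. }
  assert (Hsum : forall a i t, coop_matrix K a -> 0 < t ->
    0 <= sum4 (fun j => a i j * w t j) + K * w t i /\
    forall j, i <> j -> 0 < a i j -> 0 < w t j -> 0 < sum4 (fun j => a i j * w t j) + K * w t i).
  { intros a i t Ha Ht.
    assert (Hoff : forall j, i <> j -> 0 <= a i j * w t j).
    { intros j Hij; apply Rmult_le_pos; [apply (cm_offdiag K a Ha); exact Hij | apply Hge; lra]. }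
    assert (Hdiag : 0 <= a i i * w t i + K * w t i).
    { pose proof (cm_bound K a Ha i i) as Hb; pose proof (Hge t (Rlt_le _ _ Ht) i).
      pose proof (Rle_abs (- a i i)) as Hb'; rewrite Rabs_Ropp in Hb'; nra. }
    split.
    - unfold sum4; destruct i;
      (assert (H1 := Hoff X1); assert (H2 := Hoff X2); assert (H3 := Hoff X3); assert (H4 := Hoff X4));
      repeat match goal with H : ?x <> ?x -> _ |- _ => clear H end;
      repeat match goal with H : ?x <> ?y -> _ |- _ => specialize (H ltac:(discriminate)) end; lra.
    - intros j Hij Hpa Hpw; assert (Hp : 0 < a i j * w t j) by (apply Rmult_lt_0_compat; assumption).
      unfold sum4; destruct i, j; try congruence;
      (assert (H1 := Hoff X1); assert (H2 := Hoff X2); assert (H3 := Hoff X3); assert (H4 := Hoff X4));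
      repeat match goal with H : ?x <> ?x -> _ |- _ => clear H end;
      repeat match goal with H : ?x <> ?y -> _ |- _ => specialize (H ltac:(discriminate)) end; lra. }
  assert (Hstay : forall i, 0 < w 0 i -> forall t, 0 < t -> 0 < w t i).
  { intros i Hi t Ht.
    destruct (exp_weighted_step K (fun u => w u i) 0 t) as (c & l & Hct & Hl & E); auto; [lra|].
    destruct (Hw c) as (a & Ha & Hd); [lra|].
    rewrite (uniqueness_limite _ _ _ _ Hl (Hd i)) in E.
    destruct (Hsum a i c Ha) as (Hs & _); [lra|].
    rewrite Rmult_0_r, exp_0 in E.
    assert (0 <= exp (K * c) * (sum4 (fun j => a i j * w c j) + K * w c i) * (t - 0)).
    { apply Rmult_le_pos; [apply Rmult_le_pos; [apply Rlt_le, exp_pos | exact Hs] | lra]. }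
    pose proof (exp_pos (K * t)); pose proof (Hge t (Rlt_le _ _ Ht) i).
    destruct (Req_dec (w t i) 0) as [E0 | E0]; [rewrite E0 in E|]; lra. }
  assert (Hedge : forall i j, i <> j -> (forall a, coop_matrix K a -> 0 < a i j) ->
    (forall t, 0 < t -> 0 < w t j) -> forall t, 0 < t -> 0 < w t i).
  { intros i j Hij Hpa Hpj t Ht.
    destruct (exp_weighted_step K (fun u => w u i) 0 t) as (c & l & Hct & Hl & E); auto; [lra|].
    destruct (Hw c) as (a & Ha & Hd); [lra|].
    rewrite (uniqueness_limite _ _ _ _ Hl (Hd i)) in E.
    destruct (Hsum a i c Ha) as (_ & Hs); [lra|].
    specialize (Hs j Hij (Hpa a Ha) (Hpj c (proj1 Hct))).
    rewrite Rmult_0_r, exp_0 in E.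
    assert (0 < exp (K * c) * (sum4 (fun j => a i j * w c j) + K * w c i) * (t - 0)).
    { apply Rmult_lt_0_compat; [apply Rmult_lt_0_compat; [apply exp_pos | exact Hs] | lra]. }
    pose proof (exp_pos (K * t)); pose proof (Hge t (Rlt_le _ _ Ht) i); specialize (H0 i).
    destruct (Req_dec (w t i) 0) as [E0 | E0]; [rewrite E0 in E|]; lra. }
  pose (Q := fun i => forall t, 0 < t -> 0 < w t i).
  assert (E12 : Q X1 -> Q X2) by (refine (Hedge X2 X1 _ _); [discriminate | apply cm_12]).
  assert (E24 : Q X2 -> Q X4) by (refine (Hedge X4 X2 _ _); [discriminate | apply cm_24]).
  assert (E34 : Q X3 -> Q X4) by (refine (Hedge X4 X3 _ _); [discriminate | apply cm_34]).
  assert (E41 : Q X4 -> Q X1) by (refine (Hedge X1 X4 _ _); [discriminate | apply cm_41]).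
  assert (E43 : Q X4 -> Q X3) by (refine (Hedge X3 X4 _ _); [discriminate | apply cm_43]).
  destruct Hj as (j & Hj); assert (HQ : Q j) by exact (Hstay j Hj).
  assert (H4 : Q X4) by (destruct j; auto).
  intros t Ht i; assert (Hi : Q i) by (destruct i; auto); exact (Hi t Ht).
Qed.

Definition sol (D : V -> Prop) (F : V -> V) (x : traj) : Prop :=
  (forall t, 0 <= t -> D (x t)) /\ (forall i t, continuity_pt (fun u => x u i) t) /\
  (forall i t, 0 < t -> derivable_pt_lim (fun u => x u i) t (F (x t) i)).

Section Solutions.
Variables (K : R) (D : V -> Prop) (F : V -> V).
Hypothesis HF : coop_field K D F.

Lemma sol_diff_coop x y : sol D F x -> sol D F y -> coop_linear K (fun t i => y t i - x t i).
Proof.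
  destruct HF as (HK & HF'); intros (Dx & Cx & Lx) (Dy & Cy & Ly); split; [exact HK|]; split.
  - intros i t; apply (continuity_pt_minus (fun u => y u i) (fun u => x u i)); auto.
  - intros t Ht; destruct (HF' (x t) (y t)) as (a & Ha & Ea); [apply Dx; lra | apply Dy; lra |].
    exists a; split; [exact Ha|]; intro i; rewrite <- Ea.
    apply (derivable_pt_lim_minus (fun u => y u i) (fun u => x u i)); auto.
Qed.

Lemma sol_mono x y t : sol D F x -> sol D F y -> vle (x 0) (y 0) -> 0 <= t -> vle (x t) (y t).
Proof.
  intros Hx Hy H Ht i.
  pose proof (coop_linear_nonneg K _ (sol_diff_coop x y Hx Hy)) as Hn; simpl in Hn.
  specialize (Hn ltac:(intro j; specialize (H j); lra) t Ht i); lra.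
Qed.

Lemma sol_unique x y t : sol D F x -> sol D F y -> x 0 = y 0 -> 0 <= t -> x t = y t.
Proof.
  intros Hx Hy E Ht; apply vle_antisym; apply sol_mono; auto; rewrite E; apply vle_refl.
Qed.

Lemma sol_strong x y t : sol D F x -> sol D F y -> vle (x 0) (y 0) -> x 0 <> y 0 -> 0 < t ->
  vll (x t) (y t).
Proof.
  intros Hx Hy H Hne Ht i.
  pose proof (coop_linear_strong K _ (sol_diff_coop x y Hx Hy)) as Hn; simpl in Hn.
  assert (0 < y t i - x t i); [|lra].
  apply Hn; auto.
  - intro j; specialize (H j); lra.
  - apply NNPP; intro Hno; apply Hne, vle_antisym; [exact H|].
    intro j; apply Rnot_lt_le; intro; apply Hno; exists j; lra.
Qed.

Lemma sol_dep x y d t : sol D F x -> sol D F y -> 0 < d -> near d (x 0) (y 0) -> 0 <= t ->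
  near (d * exp ((4 * K + 1) * t)) (x t) (y t).
Proof.
  intros Hx Hy Hd Hn Ht i.
  assert (H1 : forall j, - d < y 0 j - x 0 j)
    by (intro j; specialize (Hn j); apply Rabs_def2 in Hn; lra).
  assert (H2 : forall j, - d < x 0 j - y 0 j)
    by (intro j; specialize (Hn j); apply Rabs_def2 in Hn; lra).
  pose proof (coop_linear_lower K _ d (sol_diff_coop x y Hx Hy) Hd H1 t Ht i).
  pose proof (coop_linear_lower K _ d (sol_diff_coop y x Hy Hx) Hd H2 t Ht i).
  simpl in *; apply Rabs_def1; lra.
Qed.

Lemma sol_shift x t0 : sol D F x -> 0 <= t0 -> sol D F (shift t0 x).
Proof.
  intros (Dx & Cx & Lx) Ht0; unfold shift; split; [|split].
  - intros t Ht; apply Dx; lra.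
  - intros i t; apply (continuity_pt_comp (fun t => t0 + t) (fun u => x u i)); [|apply Cx].
    apply (continuity_pt_plus (fct_cte t0) id); [apply continuity_pt_const; intros ? ?; reflexivity|].
    apply derivable_continuous_pt, derivable_pt_id.
  - intros i t Ht; rewrite <- (Rmult_1_r (F (x (t0 + t)) i)).
    apply (derivable_pt_lim_comp (fun t => t0 + t) (fun u => x u i)); [|apply Lx; lra].
    rewrite <- (Rplus_0_l 1).
    apply (derivable_pt_lim_plus (fct_cte t0) id); [apply derivable_pt_lim_const | apply derivable_pt_lim_id].
Qed.

Lemma field_lipschitz u v e i : D u -> D v -> (forall j, Rabs (v j - u j) <= e) ->
  Rabs (F v i - F u i) <= 4 * K * e.
Proof.
  intros Du Dv He; destruct HF as (HK & HF'); destruct (HF' u v Du Dv) as (a & Ha & ->).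
  rewrite Rmult_assoc; apply sum4_abs_le; intro j; rewrite Rabs_mult.
  apply Rmult_le_compat; try apply Rabs_pos; [apply (cm_bound K a Ha) | apply He].
Qed.

Variables lo hi : V.
Definition in_vbox (u : V) : Prop := forall i, lo i <= u i <= hi i.
Hypothesis HB : forall u, in_vbox u -> D u.

Definition bsol (x : traj) : Prop := sol D F x /\ forall t, 0 <= t -> in_vbox (x t).

Lemma vbox_bounded : exists B, forall u i, in_vbox u -> Rabs (u i) <= B.
Proof.
  exists (sum4 (fun j => Rabs (lo j) + Rabs (hi j))); intros u i Hu.
  assert (Rabs (u i) <= Rabs (lo i) + Rabs (hi i)).
  { specialize (Hu i); pose proof (Rle_abs (hi i)); pose proof (Rle_abs (- lo i)) as Hl.
    rewrite Rabs_Ropp in Hl; pose proof (Rabs_pos (hi i)); pose proof (Rabs_pos (lo i)).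
    apply Rabs_le; lra. }
  unfold sum4; destruct i;
  pose proof (Rabs_pos (lo X1)); pose proof (Rabs_pos (lo X2));
  pose proof (Rabs_pos (lo X3)); pose proof (Rabs_pos (lo X4));
  pose proof (Rabs_pos (hi X1)); pose proof (Rabs_pos (hi X2));
  pose proof (Rabs_pos (hi X3)); pose proof (Rabs_pos (hi X4)); lra.
Qed.

Lemma field_bounded : exists M, 0 < M /\ forall u i, in_vbox u -> Rabs (F u i) <= M.
Proof.
  destruct (classic (exists u0, in_vbox u0)) as [(u0 & H0) | Hn].
  - set (B := sum4 (fun j => Rabs (hi j - lo j))).
    assert (HBj : forall j, Rabs (hi j - lo j) <= B).
    { intro j; unfold B, sum4; pose proof (Rabs_pos (hi X1 - lo X1));
      pose proof (Rabs_pos (hi X2 - lo X2)); pose proof (Rabs_pos (hi X3 - lo X3));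
      pose proof (Rabs_pos (hi X4 - lo X4)); destruct j; lra. }
    exists (1 + sum4 (fun j => Rabs (F u0 j)) + Rabs (4 * K * B)); split.
    + unfold sum4; pose proof (Rabs_pos (F u0 X1)); pose proof (Rabs_pos (F u0 X2));
      pose proof (Rabs_pos (F u0 X3)); pose proof (Rabs_pos (F u0 X4));
      pose proof (Rabs_pos (4 * K * B)); lra.
    + intros u i Hu.
      assert (Hd : Rabs (F u i - F u0 i) <= 4 * K * B).
      { apply field_lipschitz; auto; intro j; specialize (H0 j); specialize (Hu j).
        specialize (HBj j); pose proof (Rle_abs (hi j - lo j)); apply Rabs_le; lra. }
      assert (Hi : Rabs (F u0 i) <= sum4 (fun j => Rabs (F u0 j))).
      { unfold sum4; pose proof (Rabs_pos (F u0 X1)); pose proof (Rabs_pos (F u0 X2));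
        pose proof (Rabs_pos (F u0 X3)); pose proof (Rabs_pos (F u0 X4)); destruct i; lra. }
      pose proof (Rabs_triang (F u i - F u0 i) (F u0 i)) as Ht.
      replace (F u i - F u0 i + F u0 i) with (F u i) in Ht by ring.
      pose proof (Rle_abs (4 * K * B)); lra.
  - exists 1; split; [lra|]; intros u i Hu; exfalso; apply Hn; exists u; exact Hu.
Qed.

Lemma bsol_lipschitz M x s t i : (forall u i, in_vbox u -> Rabs (F u i) <= M) -> bsol x ->
  0 <= s -> 0 <= t -> Rabs (x t i - x s i) <= M * Rabs (t - s).
Proof.
  intros HM ((Dx & Cx & Lx) & Bx).
  assert (Hlt : forall s t, 0 <= s < t -> Rabs (x t i - x s i) <= M * Rabs (t - s)).
  { intros s0 t0 Hst; destruct (mean_value (fun u => x u i) s0 t0) as (c & l & Hc & Hl & ->).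
    - lra.
    - apply Cx.
    - intros r Hr; eexists; apply Lx; lra.
    - rewrite (uniqueness_limite _ _ _ _ Hl (Lx i c ltac:(lra))), Rabs_mult.
      apply Rmult_le_compat_r; [apply Rabs_pos | apply HM, Bx; lra]. }
  intros Hs Ht; destruct (Rtotal_order s t) as [H | [-> | H]].
  - apply Hlt; lra.
  - rewrite !Rminus_diag, Rabs_R0; lra.
  - rewrite (Rabs_minus_sym (x t i)), (Rabs_minus_sym t); apply Hlt; lra.
Qed.

(* This form of the equation survives pointwise limits. *)
Lemma bsol_taylor M x s t i : (forall u i, in_vbox u -> Rabs (F u i) <= M) -> bsol x ->
  0 <= s -> 0 <= t -> Rabs (x s i - x t i - (s - t) * F (x t) i) <= 4 * K * M * (s - t) ^ 2.
Proof.
  intros HM Hx Hs Ht; pose proof Hx as ((Dx & Cx & Lx) & Bx).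
  assert (HM0 : 0 <= M).
  { pose proof (HM _ X1 (Bx 0 (Rle_refl 0))); pose proof (Rabs_pos (F (x 0) X1)); lra. }
  assert (Hc : exists c, 0 <= c /\ Rabs (c - t) <= Rabs (s - t) /\
                 x s i - x t i = F (x c) i * (s - t)).
  { destruct (Rtotal_order s t) as [H | [-> | H]].
    - destruct (mean_value (fun u => x u i) s t) as (c & l & Hc & Hl & E); [lra | apply Cx | |].
      + intros r Hr; eexists; apply Lx; lra.
      + rewrite (uniqueness_limite _ _ _ _ Hl (Lx i c ltac:(lra))) in E.
        exists c; repeat split; [lra| |lra].
        rewrite !Rabs_left1; lra.
    - exists t; repeat split; lra.
    - destruct (mean_value (fun u => x u i) t s) as (c & l & Hc & Hl & E); [lra | apply Cx | |].
      + intros r Hr; eexists; apply Lx; lra.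
      + rewrite (uniqueness_limite _ _ _ _ Hl (Lx i c ltac:(lra))) in E.
        exists c; repeat split; [lra| |lra].
        rewrite !Rabs_pos_eq; lra. }
  destruct Hc as (c & Hc & Hcs & ->).
  replace (F (x c) i * (s - t) - (s - t) * F (x t) i) with ((F (x c) i - F (x t) i) * (s - t)) by ring.
  rewrite Rabs_mult, <- (pow2_abs (s - t)).
  replace (4 * K * M * Rabs (s - t) ^ 2) with (4 * K * (M * Rabs (s - t)) * Rabs (s - t)) by ring.
  apply Rmult_le_compat_r; [apply Rabs_pos|].
  apply field_lipschitz; auto.
  intro j; eapply Rle_trans; [apply (bsol_lipschitz M); auto|].
  apply Rmult_le_compat_l; assumption.
Qed.

Lemma taylor_derivable f t l Q : 0 < t ->
  (forall s, 0 <= s -> Rabs (f s - f t - (s - t) * l) <= Q * (s - t) ^ 2) -> derivable_pt_lim f t l.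
Proof.
  intros Ht H e He.
  assert (Hd : 0 < Rmin t (e / (Rabs Q + 1))).
  { apply Rmin_glb_lt; [exact Ht|]; apply Rdiv_lt_0_compat; [exact He|].
    pose proof (Rabs_pos Q); lra. }
  exists (mkposreal _ Hd); intros h Hh Hhd; simpl in Hhd.
  pose proof (Rmin_l t (e / (Rabs Q + 1))); pose proof (Rmin_r t (e / (Rabs Q + 1))).
  assert (Hth : - h <= Rabs h) by (pose proof (Rle_abs (- h)) as X; rewrite Rabs_Ropp in X; exact X).
  specialize (H (t + h) ltac:(lra)); replace (t + h - t) with h in H by ring.
  replace ((f (t + h) - f t) / h - l) with ((f (t + h) - f t - h * l) / h) by (field; exact Hh).
  unfold Rdiv; rewrite Rabs_mult, Rabs_inv.
  pose proof (Rabs_pos_lt h Hh) as Hp; pose proof (Rabs_pos Q).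
  apply Rmult_lt_reg_r with (Rabs h); [exact Hp|].
  rewrite Rmult_assoc, Rinv_l, Rmult_1_r by lra.
  rewrite <- (pow2_abs h) in H; pose proof (Rle_abs Q).
  assert (Hq : (Rabs Q + 1) * Rabs h < e).
  { replace e with ((Rabs Q + 1) * (e / (Rabs Q + 1))) by (field; lra).
    apply Rmult_lt_compat_l; lra. }
  nra.
Qed.

Lemma bsol_limit x p : bsol x -> Om x p -> exists y, bsol y /\ y 0 = p.
Proof.
  intros Hx Hp; destruct field_bounded as (M & HM0 & HM).
  assert (HK := proj1 HF).
  destruct vbox_bounded as (B & HBd).
  assert (Hex : forall t, exists v, 0 <= t -> forall e, 0 < e -> exists d, 0 < d /\
     forall s, 0 <= s -> near d (x s) p -> near e (x (s + t)) v).
  { intro t; destruct (Rle_lt_dec 0 t) as [Ht | Ht]; [|exists p; intro; lra].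
    destruct (cluster_point (fun e s => 0 <= s /\ near e (x s) p) (shift t x) B) as (v & Hv).
    - intros e e' s He (Hs & Hn); split; [exact Hs | exact (near_weaken _ _ _ _ He Hn)].
    - intros s i Hs; apply HBd, (proj2 Hx); lra.
    - intros e T0 He; destruct (Hp e T0 He) as (s & ? & ? & ?); exists s; auto.
    - exists v; intros _ e He.
      set (E := exp ((4 * K + 1) * t)); assert (HE : 0 < E) by apply exp_pos.
      assert (Hd : 0 < e / 2 / E / 2).
      { repeat apply Rdiv_lt_0_compat; lra. }
      exists (e / 2 / E / 2); split; [exact Hd|]; intros s Hs Hn.
      destruct (Hv (Rmin (e / 2) (e / 2 / E / 2)) 0) as (r & _ & Hr & (_ & Hrp) & Hrv).
      { apply Rmin_glb_lt; lra. }
      replace e with (e / 2 / E * E + e / 2) by (field; lra).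
      apply near_trans with (x (r + t)).
      + assert (Hsr : near (e / 2 / E) (shift s x 0) (shift r x 0)).
        { unfold shift; rewrite !Rplus_0_r.
          replace (e / 2 / E) with (e / 2 / E / 2 + e / 2 / E / 2) by (field; lra).
          eapply near_trans; [exact Hn|]; apply near_sym.
          eapply near_weaken; [apply Rmin_r | exact Hrp]. }
        apply (sol_dep (shift s x) (shift r x) (e / 2 / E) t); auto;
          try (apply sol_shift; [apply Hx | assumption]); lra.
      + unfold shift in Hrv; rewrite (Rplus_comm t r) in Hrv.
        eapply near_weaken; [apply Rmin_l | exact Hrv]. }
  pose (v := fun t => proj1_sig (constructive_indefinite_description _ (Hex t))).
  assert (Hv : forall t, 0 <= t -> forall e, 0 < e -> exists d, 0 < d /\
     forall s, 0 <= s -> near d (x s) p -> near e (x (s + t)) (v t)).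
  { intro t; unfold v; destruct (constructive_indefinite_description _ (Hex t)) as (v' & Hv'); exact Hv'. }
  assert (Happrox : forall s t e, 0 <= s -> 0 <= t -> 0 < e -> exists r, 0 <= r /\
     near e (x (r + s)) (v s) /\ near e (x (r + t)) (v t)).
  { intros s t e Hs Ht He; destruct (Hv s Hs e He) as (d1 & Hd1 & H1), (Hv t Ht e He) as (d2 & Hd2 & H2).
    destruct (Hp (Rmin d1 d2) 0) as (r & _ & Hr & Hn); [apply Rmin_glb_lt; assumption|].
    exists r; repeat split; [exact Hr | apply H1 | apply H2]; auto;
      eapply near_weaken; try exact Hn; [apply Rmin_l | apply Rmin_r]. }
  assert (Hbox : forall t, 0 <= t -> in_vbox (v t)).
  { intros t Ht i; split; apply Rnot_lt_le; intro Hlt.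
    - destruct (Happrox t t (lo i - v t i) Ht Ht) as (r & Hr & Hn & _); [lra|].
      specialize (Hn i); apply Rabs_def2 in Hn; pose proof (proj2 Hx (r + t) ltac:(lra) i); lra.
    - destruct (Happrox t t (v t i - hi i) Ht Ht) as (r & Hr & Hn & _); [lra|].
      specialize (Hn i); apply Rabs_def2 in Hn; pose proof (proj2 Hx (r + t) ltac:(lra) i); lra. }
  assert (Hlip : forall s t i, 0 <= s -> 0 <= t -> Rabs (v t i - v s i) <= M * Rabs (t - s)).
  { intros s t i Hs Ht; apply le_epsilon; intros e He.
    destruct (Happrox s t (e / 2) Hs Ht) as (r & Hr & N1 & N2); [lra|].
    specialize (N1 i); specialize (N2 i).
    pose proof (bsol_lipschitz M x (r + s) (r + t) i HM Hx ltac:(lra) ltac:(lra)) as Hl.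
    replace (r + t - (r + s)) with (t - s) in Hl by ring.
    replace (v t i - v s i) with
      (- (x (r + t) i - v t i) + ((x (r + t) i - x (r + s) i) + (x (r + s) i - v s i))) by ring.
    pose proof (Rabs_triang (- (x (r + t) i - v t i))
                  ((x (r + t) i - x (r + s) i) + (x (r + s) i - v s i))) as Ha.
    pose proof (Rabs_triang (x (r + t) i - x (r + s) i) (x (r + s) i - v s i)).
    rewrite Rabs_Ropp in Ha; lra. }
  assert (Htay : forall s t i, 0 <= s -> 0 <= t ->
     Rabs (v s i - v t i - (s - t) * F (v t) i) <= 4 * K * M * (s - t) ^ 2).
  { intros s t i Hs Ht; apply le_epsilon; intros e He.
    set (A := 2 + Rabs (s - t) * (4 * K)).
    assert (HA : 2 <= A).
    { unfold A; pose proof (Rabs_pos (s - t)).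
      assert (0 <= Rabs (s - t) * (4 * K)) by (apply Rmult_le_pos; lra); lra. }
    destruct (Happrox s t (e / A) Hs Ht) as (r & Hr & N1 & N2); [apply Rdiv_lt_0_compat; lra|].
    pose proof (bsol_taylor M x (r + s) (r + t) i HM Hx ltac:(lra) ltac:(lra)) as Hl.
    replace (r + s - (r + t)) with (s - t) in Hl by ring.
    assert (HFn : Rabs (F (x (r + t)) i - F (v t) i) <= 4 * K * (e / A)).
    { apply field_lipschitz; [apply HB, Hbox, Ht | apply HB, (proj2 Hx); lra |].
      intro j; apply Rlt_le, N2. }
    specialize (N1 i); specialize (N2 i).
    set (c := x (r + s) i - x (r + t) i - (s - t) * F (x (r + t)) i) in *.
    replace (v s i - v t i - (s - t) * F (v t) i) with
      (c + (- (x (r + s) i - v s i) + ((x (r + t) i - v t i) + (s - t) * (F (x (r + t)) i - F (v t) i))))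
      by (unfold c; ring).
    pose proof (Rabs_triang c (- (x (r + s) i - v s i) + ((x (r + t) i - v t i)
       + (s - t) * (F (x (r + t)) i - F (v t) i)))).
    pose proof (Rabs_triang (- (x (r + s) i - v s i)) ((x (r + t) i - v t i)
       + (s - t) * (F (x (r + t)) i - F (v t) i))) as Ha; rewrite Rabs_Ropp in Ha.
    pose proof (Rabs_triang (x (r + t) i - v t i) ((s - t) * (F (x (r + t)) i - F (v t) i))) as Hb.
    rewrite (Rabs_mult (s - t)) in Hb.
    assert (Rabs (s - t) * Rabs (F (x (r + t)) i - F (v t) i) <= Rabs (s - t) * (4 * K * (e / A)))
      by (apply Rmult_le_compat_l; [apply Rabs_pos | exact HFn]).
    assert (HeA : e = A * (e / A)) by (field; lra).
    unfold A in HeA at 1; nra. }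
  exists (fun t => v (Rmax 0 t)); split; [split; [split; [|split]|]|].
  - intros t Ht; rewrite Rmax_right by lra; apply HB, Hbox, Ht.
  - intros i t e He; exists (e / M); split; [apply Rdiv_lt_0_compat; assumption|].
    intros s (_ & Hs); simpl in *; unfold Rdist in *.
    eapply Rle_lt_trans; [apply Hlip; apply Rmax_l|].
    assert (Rabs (Rmax 0 s - Rmax 0 t) <= Rabs (s - t)).
    { unfold Rmax; destruct (Rle_dec 0 s), (Rle_dec 0 t); unfold Rabs;
      repeat destruct Rcase_abs; lra. }
    replace e with (M * (e / M)) by (field; lra); apply Rmult_lt_compat_l; lra.
  - intros i t Ht; apply (taylor_derivable _ _ _ (4 * K * M)); [exact Ht|].
    intros s Hs; rewrite !Rmax_right by lra; apply Htay; lra.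
  - intros t Ht; rewrite Rmax_right by lra; apply Hbox, Ht.
  - rewrite Rmax_left by lra; symmetry; apply near_eq; intros e He.
    destruct (Hv 0 (Rle_refl 0) (e / 2)) as (d & Hd & Hn); [lra|].
    destruct (Hp (Rmin d (e / 2)) 0) as (r & _ & Hr & Hrn); [apply Rmin_glb_lt; lra|].
    replace e with (e / 2 + e / 2) by field; apply near_trans with (x r).
    + apply near_sym; eapply near_weaken; [apply Rmin_r | exact Hrn].
    + rewrite <- (Rplus_0_r r); apply Hn; [exact Hr|].
      eapply near_weaken; [apply Rmin_l | exact Hrn].
Qed.

Lemma bsol_strongly_monotone : strongly_monotone bsol.
Proof.
  destruct field_bounded as (M & HM0 & HM); constructor.
  - destruct vbox_bounded as (B & HBd); exists B; intros x t i (_ & Bx) Ht; apply HBd, Bx, Ht.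
  - intros e He; exists (e / (2 * M)); split; [apply Rdiv_lt_0_compat; lra|].
    intros x s t Hx Hs Ht Hst i.
    eapply Rle_lt_trans; [apply (bsol_lipschitz M); auto|].
    apply Rle_lt_trans with (M * (e / (2 * M))); [apply Rmult_le_compat_l; lra|].
    replace (M * (e / (2 * M))) with (e / 2) by (field; lra); lra.
  - intros x t0 (Hx & Bx) Ht0; split; [apply sol_shift; assumption|].
    intros t Ht; apply Bx; lra.
  - intros x y t (Hx & _) (Hy & _); apply sol_mono; assumption.
  - intros x y t (Hx & _) (Hy & _); apply sol_strong; assumption.
  - intros t e Ht He; set (E := exp ((4 * K + 1) * t)); assert (HE : 0 < E) by apply exp_pos.
    exists (e / E); split; [apply Rdiv_lt_0_compat; assumption|].
    intros x y (Hx & _) (Hy & _) Hn; replace e with (e / E * E) by (field; lra).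
    apply sol_dep; auto; apply Rdiv_lt_0_compat; assumption.
  - intros x p; apply bsol_limit.
Qed.

End Solutions.

(** * The signed vector field is cooperative *)

Definition toV (x : P4) : V := fun i =>
  match i with X1 => - mu34 x | X2 => sv x | X3 => - mu200 x | X4 => zv x end.
Definition ofV (u : V) : P4 := mkP4 (- u X1) (u X2) (- u X3) (u X4).

Lemma ofV_toV x : ofV (toV x) = x.
Proof. destruct x; unfold ofV, toV; simpl; f_equal; ring. Qed.

Lemma toV_ofV u : toV (ofV u) = u.
Proof. apply vext; intros [| | |]; simpl; ring. Qed.

Definition signed_orthant (u : V) : Prop := in_orthant (ofV u).
Definition signed_field (p : Params) (u : V) : V := toV (G p (ofV u)).

Definition decreasing_slope (h : R -> R) (K : R) : Prop :=
  forall x y, 0 < x -> 0 < y -> exists a, 0 < a <= K /\ h y - h x = - a * (y - x).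
Definition positive_bounded (h : R -> R) (B : R) : Prop := forall x, 0 < x -> 0 < h x <= B.

Lemma hill_slope A : 0 < A -> decreasing_slope (fun s => / (s ^ 2 + A)) (2 * (1 + / A) * / A).
Proof.
  intros HA x y Hx Hy.
  assert (Hq : forall s, 0 < s -> 0 < / (s ^ 2 + A) <= / A).
  { intros s Hs; assert (0 < s ^ 2) by (apply pow_lt; exact Hs).
    split; [apply Rinv_0_lt_compat; lra | apply Rinv_le_contravar; lra]. }
  assert (Hs : forall s, 0 < s -> 0 < s * / (s ^ 2 + A) <= 1 + / A).
  { intros s Hs; assert (0 < s ^ 2) by (apply pow_lt; exact Hs).
    destruct (Hq s Hs) as (H1 & H2).
    split; [apply Rmult_lt_0_compat; assumption|].
    destruct (Rle_lt_dec s 1).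
    - assert (s * / (s ^ 2 + A) <= 1 * / A) by (apply Rmult_le_compat; lra); lra.
    - assert (s * / (s ^ 2 + A) <= 1); [|assert (0 < / A) by (apply Rinv_0_lt_compat, HA); lra].
      apply Rmult_le_reg_r with (s ^ 2 + A); [lra|].
      rewrite Rmult_assoc, Rinv_l by lra; nra. }
  exists (x * / (x ^ 2 + A) * / (y ^ 2 + A) + y * / (y ^ 2 + A) * / (x ^ 2 + A)); split.
  - destruct (Hq x Hx) as (Hx1 & Hx2), (Hq y Hy) as (Hy1 & Hy2),
      (Hs x Hx) as (Hx3 & Hx4), (Hs y Hy) as (Hy3 & Hy4).
    set (a := / (x ^ 2 + A)) in *; set (b := / (y ^ 2 + A)) in *.
    assert (0 < x * a * b) by (apply Rmult_lt_0_compat; lra).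
    assert (0 < y * b * a) by (apply Rmult_lt_0_compat; lra).
    assert (x * a * b <= (1 + / A) * / A) by (apply Rmult_le_compat; lra).
    assert (y * b * a <= (1 + / A) * / A) by (apply Rmult_le_compat; lra).
    split; lra.
  - pose proof (pow_lt x 2 Hx); pose proof (pow_lt y 2 Hy); field; split; lra.
Qed.

Lemma hill_positive A : 0 < A -> positive_bounded (fun s => / (s ^ 2 + A)) (/ A).
Proof.
  intros HA s Hs; assert (0 < s ^ 2) by (apply pow_lt; exact Hs).
  split; [apply Rinv_0_lt_compat; lra | apply Rinv_le_contravar; lra].
Qed.

Lemma quadratic_ratio_slope p0 p1 p2 q0 q1 q2 :
  0 < q0 -> 0 < q1 -> 0 < q2 ->
  p1 * q0 < p0 * q1 -> p2 * q0 < p0 * q2 -> p2 * q1 < p1 * q2 ->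
  exists K, decreasing_slope
    (fun m => (p0 + p1 * m + p2 * m ^ 2) / (q0 + q1 * m + q2 * m ^ 2)) K.
Proof.
  intros Hq0 Hq1 Hq2 H10 H20 H21.
  set (r := Rmin q0 q1); assert (Hr : 0 < r) by (apply Rmin_glb_lt; assumption).
  assert (Hr0 : r <= q0) by apply Rmin_l; assert (Hr1 : r <= q1) by apply Rmin_r.
  set (c10 := p0 * q1 - p1 * q0); set (c20 := p0 * q2 - p2 * q0); set (c21 := p1 * q2 - p2 * q1).
  assert (0 < c10) by (unfold c10; lra); assert (0 < c20) by (unfold c20; lra);
  assert (0 < c21) by (unfold c21; lra).
  exists ((c10 + c20 + c21) / (r * r)); intros x y Hx Hy.
  set (Dx := q0 + q1 * x + q2 * x ^ 2); set (Dy := q0 + q1 * y + q2 * y ^ 2).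
  assert (HDx : r * (1 + x) <= Dx) by (unfold Dx; nra).
  assert (HDy : r * (1 + y) <= Dy) by (unfold Dy; nra).
  assert (Hrx : 0 < r * (1 + x)) by (apply Rmult_lt_0_compat; lra).
  assert (Hry : 0 < r * (1 + y)) by (apply Rmult_lt_0_compat; lra).
  assert (Hxy : 0 < x * y) by (apply Rmult_lt_0_compat; assumption).
  exists ((c10 + c20 * (x + y) + c21 * (x * y)) / (Dx * Dy)).
  assert (HDD : r * (1 + x) * (r * (1 + y)) <= Dx * Dy) by (apply Rmult_le_compat; lra).
  assert (Hpp : 0 < r * (1 + x) * (r * (1 + y))) by (apply Rmult_lt_0_compat; assumption).
  assert (Hc1 : 0 < c20 * (x + y)) by (apply Rmult_lt_0_compat; lra).
  assert (Hc2 : 0 < c21 * (x * y)) by (apply Rmult_lt_0_compat; lra).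
  split; [split|].
  - apply Rdiv_lt_0_compat; lra.
  - apply Rle_trans with ((c10 + c20 + c21) * ((1 + x) * (1 + y)) / (r * (1 + x) * (r * (1 + y)))).
    + apply Rmult_le_compat; try lra.
      * apply Rlt_le, Rinv_0_lt_compat; lra.
      * assert (0 < c10 * (x + y + x * y)) by (apply Rmult_lt_0_compat; lra).
        assert (0 < c20 * (1 + x * y)) by (apply Rmult_lt_0_compat; lra).
        assert (0 < c21 * (1 + x + y)) by (apply Rmult_lt_0_compat; lra).
        nra.
      * apply Rinv_le_contravar; assumption.
    + right; field; lra.
  - unfold c10, c20, c21; fold Dx Dy; unfold Rdiv at 1 2.
    assert (Dx <> 0) by lra; assert (Dy <> 0) by lra.
    apply Rmult_eq_reg_r with (Dx * Dy); [|apply Rmult_integral_contrapositive; auto].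
    transitivity ((p0 + p1 * y + p2 * y ^ 2) * Dx - (p0 + p1 * x + p2 * x ^ 2) * Dy); [field; auto|].
    transitivity (- (p0 * q1 - p1 * q0 + (p0 * q2 - p2 * q0) * (x + y)
                     + (p1 * q2 - p2 * q1) * (x * y)) * (y - x)); [unfold Dx, Dy; ring|].
    field; auto.
Qed.

Lemma Nfun_decreasing k k1 k2 b b1 b2 c cm :
  0 < b -> b < b1 -> b1 < b2 -> 0 < c -> 0 < cm -> 0 < k2 -> k2 < k1 -> k1 < k ->
  exists K, decreasing_slope (Nfun k k1 k2 b b1 b2 c cm) K.
Proof.
  intros Hb Hb1 Hb2 Hc Hcm Hk2 Hk1 Hk.
  assert (He1 : 0 < e1 b1 b2 cm).
  { unfold e1; assert (0 < b1 * b2) by (apply Rmult_lt_0_compat; lra).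
    assert (0 < (b1 + b2) * cm) by (apply Rmult_lt_0_compat; lra).
    pose proof (pow_lt cm 2 Hcm); lra. }
  assert (He3 : 0 < e3 b b1 b2 cm).
  { unfold e3; assert (0 < b * b2) by (apply Rmult_lt_0_compat; lra).
    assert (0 < b1 * b2) by (apply Rmult_lt_0_compat; lra).
    assert (0 < b1 * cm) by (apply Rmult_lt_0_compat; lra); lra. }
  pose proof (pow_lt c 2 Hc) as Hc2.
  destruct (quadratic_ratio_slope (k * e1 b1 b2 cm) (k * (b2 * c) + k1 * e2 c b2 cm) (k2 * c ^ 2)
              (e1 b1 b2 cm * b) (e3 b b1 b2 cm * c) (b2 * c ^ 2)) as (K & HK).
  - apply Rmult_lt_0_compat; assumption.
  - apply Rmult_lt_0_compat; assumption.
  - apply Rmult_lt_0_compat; lra.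
  - apply Rlt_0_minus.
    replace (_ - _) with (e1 b1 b2 cm * (c * (b2 + cm) * (k * b1 - k1 * b))) by (unfold e2, e3; ring).
    repeat apply Rmult_lt_0_compat; try lra; nra.
  - apply Rlt_0_minus.
    replace (_ - _) with (e1 b1 b2 cm * (c ^ 2 * (k * b2 - k2 * b))) by ring.
    repeat apply Rmult_lt_0_compat; try lra; nra.
  - apply Rlt_0_minus.
    replace (_ - _) with (c ^ 2 * (c * (b2 * (k * b2 - k2 * b) + b2 * (k1 * b2 - k2 * b1)
         + cm * (k1 * b2 - k2 * b1)))) by (unfold e2, e3; ring).
    assert (0 < k * b2 - k2 * b) by nra; assert (0 < k1 * b2 - k2 * b1) by nra.
    repeat apply Rmult_lt_0_compat; try lra.
    repeat apply Rplus_lt_0_compat; apply Rmult_lt_0_compat; lra.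
  - exists K; intros x y Hx Hy; destruct (HK x y Hx Hy) as (a & Ha & E); exists a; split; [exact Ha|].
    rewrite <- E; unfold Nfun, Defs.Delta.
    f_equal; apply f_equal2; try apply f_equal; ring.
Qed.

Lemma Nfun_positive_bounded k k1 k2 b b1 b2 c cm :
  0 < b -> b < b1 -> b1 < b2 -> 0 < c -> 0 < cm -> 0 < k2 -> k2 < k1 -> k1 < k ->
  exists B, positive_bounded (Nfun k k1 k2 b b1 b2 c cm) B.
Proof.
  intros Hb Hb1 Hb2 Hc Hcm Hk2 Hk1 Hk; exists (k / b); intros m Hm.
  assert (He1 : 0 < e1 b1 b2 cm).
  { unfold e1; assert (0 < b1 * b2) by (apply Rmult_lt_0_compat; lra).
    assert (0 < (b1 + b2) * cm) by (apply Rmult_lt_0_compat; lra).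
    pose proof (pow_lt cm 2 Hcm); lra. }
  assert (He2 : 0 < e2 c b2 cm) by (unfold e2; apply Rmult_lt_0_compat; lra).
  assert (He3 : 0 < e3 b b1 b2 cm).
  { unfold e3; assert (0 < b * b2) by (apply Rmult_lt_0_compat; lra).
    assert (0 < b1 * b2) by (apply Rmult_lt_0_compat; lra).
    assert (0 < b1 * cm) by (apply Rmult_lt_0_compat; lra); lra. }
  pose proof (pow_lt c 2 Hc) as Hc2; pose proof (pow_lt m 2 Hm) as Hm2.
  assert (HD : 0 < Defs.Delta b b1 b2 c cm m).
  { unfold Defs.Delta.
    assert (0 < b2 * c ^ 2 * m ^ 2) by (repeat apply Rmult_lt_0_compat; lra).
    assert (0 < e3 b b1 b2 cm * c * m) by (repeat apply Rmult_lt_0_compat; lra).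
    assert (0 < e1 b1 b2 cm * b) by (repeat apply Rmult_lt_0_compat; lra); lra. }
  unfold Nfun; split.
  - apply Rdiv_lt_0_compat; [|exact HD].
    assert (0 < k * (b2 * c * m + e1 b1 b2 cm)).
    { apply Rmult_lt_0_compat; [lra|].
      assert (0 < b2 * c * m) by (repeat apply Rmult_lt_0_compat; lra); lra. }
    assert (0 < k1 * e2 c b2 cm * m) by (repeat apply Rmult_lt_0_compat; lra).
    assert (0 < k2 * c ^ 2 * m ^ 2) by (repeat apply Rmult_lt_0_compat; lra); lra.
  - apply Rmult_le_reg_r with (Defs.Delta b b1 b2 c cm m * b); [apply Rmult_lt_0_compat; lra|].
    replace (k / b * (Defs.Delta b b1 b2 c cm m * b)) with (k * Defs.Delta b b1 b2 c cm m) by (field; lra).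
    match goal with |- ?n / ?d * (?d * b) <= _ => replace (n / d * (d * b)) with (n * b) by (field; lra) end.
    unfold Defs.Delta, e2, e3; apply Rge_le, Rminus_ge, Rle_ge.
    match goal with |- 0 <= ?e => replace e with
      (c * m * (b2 + cm) * (k * b1 - k1 * b) + c ^ 2 * m ^ 2 * (k * b2 - k2 * b)) by (unfold e1; ring) end.
    assert (0 < k * b1 - k1 * b) by nra; assert (0 < k * b2 - k2 * b) by nra.
    assert (0 < c * m * (b2 + cm) * (k * b1 - k1 * b)) by (repeat apply Rmult_lt_0_compat; lra).
    assert (0 < c ^ 2 * m ^ 2 * (k * b2 - k2 * b)) by (repeat apply Rmult_lt_0_compat; lra). lra.
Qed.

Lemma product_bounds a b A B : 0 < a <= A -> 0 < b <= B -> 0 < a * b <= A * B.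
Proof.
  intros Ha Hb; split; [apply Rmult_lt_0_compat; lra | apply Rmult_le_compat; lra].
Qed.

Theorem signed_field_cooperative p : params_ok p ->
  exists K, coop_field K signed_orthant (signed_field p).
Proof.
  unfold params_ok; intro Hp; decompose [and] Hp; clear Hp.
  destruct (Nfun_decreasing (k_s p) (k_s1 p) (k_s2 p) (beta_s p) (beta_s1 p) (beta_s2 p) (c_s p) (c_ms p))
    as (Ks & HKs); try lra.
  destruct (Nfun_decreasing (k_z p) (k_z1 p) (k_z2 p) (beta_z p) (beta_z1 p) (beta_z2 p) (c_z p) (c_mz p))
    as (Kz & HKz); try lra.
  destruct (Nfun_positive_bounded (k_s p) (k_s1 p) (k_s2 p) (beta_s p) (beta_s1 p) (beta_s2 p) (c_s p) (c_ms p))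
    as (Bs & HBs); try lra.
  destruct (Nfun_positive_bounded (k_z p) (k_z1 p) (k_z2 p) (beta_z p) (beta_z1 p) (beta_z2 p) (c_z p) (c_mz p))
    as (Bz & HBz); try lra.
  change (decreasing_slope (N_s p) Ks) in HKs; change (decreasing_slope (N_z p) Kz) in HKz.
  change (positive_bounded (N_s p) Bs) in HBs; change (positive_bounded (N_z p) Bz) in HBz.
  assert (HAs : 0 < A_s p) by assumption; assert (HAz : 0 < A_z p) by assumption.
  pose proof (hill_slope (A_s p) HAs) as Hgs; pose proof (hill_slope (A_z p) HAz) as Hgz.
  pose proof (hill_positive (A_s p) HAs) as Pgs; pose proof (hill_positive (A_z p) HAz) as Pgz.
  set (gs := fun s => / (s ^ 2 + A_s p)) in *; set (gz := fun s => / (s ^ 2 + A_z p)) in *.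
  set (Ls := 2 * (1 + / A_s p) * / A_s p) in *; set (Lz := 2 * (1 + / A_z p) * / A_z p) in *.
  set (c1 := beta_34 p * E_34 p * A_s p * A_z p).
  set (c2 := gamma_s p * E_S p * A_s p).
  set (c3 := beta_200 p * E_200 p * A_s p * A_z p).
  set (c4 := gamma_z p * E_Z p).
  assert (Hc1 : 0 < c1) by (unfold c1; repeat apply Rmult_lt_0_compat; assumption).
  assert (Hc2 : 0 < c2) by (unfold c2; repeat apply Rmult_lt_0_compat; assumption).
  assert (Hc3 : 0 < c3) by (unfold c3; repeat apply Rmult_lt_0_compat; assumption).
  assert (Hc4 : 0 < c4) by (unfold c4; repeat apply Rmult_lt_0_compat; assumption).
  pose (qs := fun s => 1 - A_s p * gs s); pose (qz := fun s => 1 - A_z p * gz s).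
  assert (Hqs : positive_bounded qs 1).
  { intros s Hs; pose proof (pow_lt s 2 Hs).
    replace (qs s) with (s ^ 2 * gs s) by (unfold qs, gs; field; lra).
    destruct (Pgs s Hs) as (Hg & _).
    split; [apply Rmult_lt_0_compat; lra|].
    unfold gs; apply Rmult_le_reg_r with (s ^ 2 + A_s p); [lra|].
    rewrite Rmult_assoc, Rinv_l; lra. }
  assert (Hqz : positive_bounded qz 1).
  { intros s Hs; pose proof (pow_lt s 2 Hs).
    replace (qz s) with (s ^ 2 * gz s) by (unfold qz, gz; field; lra).
    destruct (Pgz s Hs) as (Hg & _).
    split; [apply Rmult_lt_0_compat; lra|].
    unfold gz; apply Rmult_le_reg_r with (s ^ 2 + A_z p); [lra|].
    rewrite Rmult_assoc, Rinv_l; lra. }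
  assert (HG1 : forall x, 0 < sv x -> 0 < zv x ->
     mu34 (G p x) = c1 * (gs (sv x) * gz (zv x)) - beta_m34 p * mu34 x).
  { intros x Hs Hz; pose proof (pow_lt _ 2 Hs); pose proof (pow_lt _ 2 Hz).
    unfold G, gs, gz, c1; simpl mu34; field; split; simpl in *; lra. }
  assert (HG2 : forall x, 0 < sv x ->
     sv (G p x) = c2 * (gs (sv x) * N_s p (mu34 x)) - k_ms p * sv x).
  { intros x Hs; pose proof (pow_lt _ 2 Hs).
    unfold G, gs, c2; simpl sv; field; simpl in *; lra. }
  assert (HG3 : forall x, 0 < sv x -> 0 < zv x ->
     mu200 (G p x) = c3 * (gs (sv x) * gz (zv x)) - beta_m200 p * mu200 x).
  { intros x Hs Hz; pose proof (pow_lt _ 2 Hs); pose proof (pow_lt _ 2 Hz).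
    unfold G, gs, gz, c3; simpl mu200; field; split; simpl in *; lra. }
  assert (HG4 : forall x, 0 < sv x -> 0 < zv x ->
     zv (G p x) = delta_z p + c4 * (qs (sv x) * qz (zv x) * N_z p (mu200 x)) - k_mz p * zv x).
  { intros x Hs Hz; pose proof (pow_lt _ 2 Hs); pose proof (pow_lt _ 2 Hz).
    unfold G, qs, qz, gs, gz, c4; simpl zv; field; split; simpl in *; lra. }
  assert (HKpos : 0 < Ks /\ 0 < Kz /\ 0 < Bs /\ 0 < Bz /\ 0 < Ls /\ 0 < Lz).
  { destruct (HKs 1 2) as (a1 & ? & _); try lra. destruct (HKz 1 2) as (a2 & ? & _); try lra.
    destruct (Hgs 1 2) as (a3 & ? & _); try lra. destruct (Hgz 1 2) as (a4 & ? & _); try lra.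
    pose proof (HBs 1); pose proof (HBz 1). lra. }
  destruct HKpos as (HKs0 & HKz0 & HBs0 & HBz0 & HLs0 & HLz0).
  pose proof (Rinv_0_lt_compat _ HAs) as HiAs; pose proof (Rinv_0_lt_compat _ HAz) as HiAz.
  pose (m12 := c1 * (Ls * / A_z p)); pose (m14 := c1 * (/ A_s p * Lz)).
  pose (m22 := c2 * (Ls * Bs)); pose (m21 := c2 * (/ A_s p * Ks)).
  pose (m32 := c3 * (Ls * / A_z p)); pose (m34 := c3 * (/ A_s p * Lz)).
  pose (m42 := c4 * (A_s p * Ls * 1 * Bz)); pose (m44 := c4 * (1 * (A_z p * Lz) * Bz)).
  pose (m43 := c4 * (1 * 1 * Kz)).
  assert (Hm : 0 < m12 /\ 0 < m14 /\ 0 < m22 /\ 0 < m21 /\ 0 < m32 /\ 0 < m34 /\ 0 < m42 /\ 0 < m44 /\ 0 < m43).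
  { repeat split; unfold m12, m14, m22, m21, m32, m34, m42, m44, m43; repeat apply Rmult_lt_0_compat; lra. }
  decompose [and] Hm; clear Hm.
  exists (m12 + m14 + m22 + m21 + m32 + m34 + m42 + m44 + m43
          + beta_m34 p + k_ms p + beta_m200 p + k_mz p).
  split; [lra|].
  intros u v Du Dv; destruct Du as (U1 & U2 & U3 & U4), Dv as (V1 & V2 & V3 & V4).
  simpl in U1, U2, U3, U4, V1, V2, V3, V4.
  destruct (Hgs (u X2) (v X2) U2 V2) as (as_ & Has & Eas).
  destruct (Hgz (u X4) (v X4) U4 V4) as (az & Haz & Eaz).
  destruct (HKs (- u X1) (- v X1) U1 V1) as (ns & Hns & Ens).
  destruct (HKz (- u X3) (- v X3) U3 V3) as (nz & Hnz & Enz).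
  pose proof (Pgs (u X2) U2) as Pgu; pose proof (Pgz (v X4) V4) as Pzv.
  pose proof (HBs (- v X1) V1) as PNs; pose proof (HBz (- v X3) V3) as PNz.
  pose proof (Hqs (u X2) U2) as Pqs; pose proof (Hqz (u X4) U4) as Pqz; pose proof (Hqz (v X4) V4) as Pqz'.
  assert (B12 : 0 < c1 * (as_ * gz (v X4)) <= m12)
    by (apply product_bounds; [lra|]; apply product_bounds; assumption).
  assert (B14 : 0 < c1 * (gs (u X2) * az) <= m14)
    by (apply product_bounds; [lra|]; apply product_bounds; assumption).
  assert (B22 : 0 < c2 * (as_ * N_s p (- v X1)) <= m22)
    by (apply product_bounds; [lra|]; apply product_bounds; assumption).
  assert (B21 : 0 < c2 * (gs (u X2) * ns) <= m21)
    by (apply product_bounds; [lra|]; apply product_bounds; assumption).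
  assert (B32 : 0 < c3 * (as_ * gz (v X4)) <= m32)
    by (apply product_bounds; [lra|]; apply product_bounds; assumption).
  assert (B34 : 0 < c3 * (gs (u X2) * az) <= m34)
    by (apply product_bounds; [lra|]; apply product_bounds; assumption).
  assert (B42 : 0 < c4 * (A_s p * as_ * qz (v X4) * N_z p (- v X3)) <= m42)
    by (apply product_bounds; [lra|]; apply product_bounds; [|assumption];
        apply product_bounds; [|assumption]; apply product_bounds; [lra|assumption]).
  assert (B44 : 0 < c4 * (qs (u X2) * (A_z p * az) * N_z p (- v X3)) <= m44)
    by (apply product_bounds; [lra|]; apply product_bounds; [|assumption];
        apply product_bounds; [assumption|]; apply product_bounds; [lra|assumption]).
  assert (B43 : 0 < c4 * (qs (u X2) * qz (u X4) * nz) <= m43)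
    by (apply product_bounds; [lra|]; apply product_bounds; [|assumption];
        apply product_bounds; assumption).
  exists (fun i j => match i, j with
    | X1, X1 => - beta_m34 p | X1, X2 => c1 * (as_ * gz (v X4)) | X1, X4 => c1 * (gs (u X2) * az)
    | X2, X1 => c2 * (gs (u X2) * ns) | X2, X2 => - (c2 * (as_ * N_s p (- v X1))) - k_ms p
    | X3, X3 => - beta_m200 p | X3, X2 => c3 * (as_ * gz (v X4)) | X3, X4 => c3 * (gs (u X2) * az)
    | X4, X2 => c4 * (A_s p * as_ * qz (v X4) * N_z p (- v X3))
    | X4, X3 => c4 * (qs (u X2) * qz (u X4) * nz)
    | X4, X4 => c4 * (qs (u X2) * (A_z p * az) * N_z p (- v X3)) - k_mz p
    | _, _ => 0 end).
  split; [constructor|].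
  - intros [| | |] [| | |]; apply Rabs_le; lra.
  - intros [| | |] [| | |] Hij; try congruence; lra.
  - lra.
  - lra.
  - lra.
  - lra.
  - lra.
  - assert (Egs : gs (v X2) = gs (u X2) - as_ * (v X2 - u X2)) by lra.
    assert (Egz : gz (u X4) = gz (v X4) + az * (v X4 - u X4)) by lra.
    assert (ENs : N_s p (- v X1) = N_s p (- u X1) + ns * (v X1 - u X1)) by lra.
    assert (ENz : N_z p (- v X3) = N_z p (- u X3) + nz * (v X3 - u X3)) by lra.
    intros [| | |]; unfold signed_field, sum4, toV.
    + rewrite !HG1 by assumption; simpl; rewrite Egs, Egz; ring.
    + rewrite !HG2 by assumption; simpl.
      replace (N_s p (- u X1)) with (N_s p (- v X1) - ns * (v X1 - u X1)) by lra.
      rewrite Egs; ring.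
    + rewrite !HG3 by assumption; simpl; rewrite Egs, Egz; ring.
    + rewrite !HG4 by assumption; simpl; unfold qs, qz.
      replace (N_z p (- u X3)) with (N_z p (- v X3) - nz * (v X3 - u X3)) by lra.
      rewrite Egs, Egz; ring.
Qed.

(** * Null sets *)

Lemma null_subset (S S' : P4 -> Prop) :
  (forall x, S x -> S' x) -> lebesgue_null4 S' -> lebesgue_null4 S.
Proof.
  intros Hs H e He; destruct (H e He) as (lo & hi & H1 & H2 & H3).
  exists lo, hi; repeat split; try apply H1; auto.
Qed.

Definition lsum {A} (f : A -> R) (l : list A) : R := fold_right (fun a s => f a + s) 0 l.

Lemma lsum_app {A} (f : A -> R) l l' : lsum f (l ++ l') = lsum f l + lsum f l'.
Proof. induction l as [|a l IH]; simpl; [ring | rewrite IH; ring]. Qed.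

Lemma lsum_nonneg {A} (f : A -> R) l : (forall a, 0 <= f a) -> 0 <= lsum f l.
Proof. intro H; induction l as [|a l IH]; simpl; [lra | specialize (H a); lra]. Qed.

Lemma lsum_incl {A} (f : A -> R) l l' : (forall a, 0 <= f a) -> NoDup l -> incl l l' ->
  lsum f l <= lsum f l'.
Proof.
  intros Hf Hl; revert l'; induction Hl as [|a l Ha Hl IH]; intros l' Hi.
  - apply lsum_nonneg, Hf.
  - destruct (in_split a l') as (l1 & l2 & ->); [apply Hi; left; reflexivity|].
    assert (Hi' : incl l (l1 ++ l2)).
    { intros b Hb; assert (Hne : b <> a) by (intros ->; contradiction).
      specialize (Hi b (or_intror Hb)); rewrite in_app_iff in *; simpl in Hi.
      destruct Hi as [|[|]]; auto; congruence. }
    specialize (IH _ Hi'); rewrite lsum_app in *; simpl; lra.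
Qed.

Lemma sum_f_R0_lsum f N : sum_f_R0 f N = lsum f (seq 0 (S N)).
Proof.
  induction N as [|N IH]; [simpl; ring|].
  rewrite seq_S, lsum_app, <- IH; simpl; ring.
Qed.

Lemma lsum_map {A B} (g : A -> B) (f : B -> R) l : lsum f (map g l) = lsum (fun a => f (g a)) l.
Proof. induction l as [|a l IH]; simpl; [reflexivity | rewrite IH; reflexivity]. Qed.

Lemma lsum_prod {A B} (f : A * B -> R) l l' :
  lsum f (list_prod l l') = lsum (fun a => lsum (fun b => f (a, b)) l') l.
Proof. induction l as [|a l IH]; simpl; [reflexivity | rewrite lsum_app, lsum_map, IH; reflexivity]. Qed.

Lemma lsum_le {A} (f g : A -> R) l : (forall a, f a <= g a) -> lsum f l <= lsum g l.
Proof. intro H; induction l as [|a l IH]; simpl; [lra | specialize (H a); lra]. Qed.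

Lemma cantor_sum_le (f : nat * nat -> R) (c : nat -> R) N : (forall a, 0 <= f a) ->
  (forall i M, sum_f_R0 (fun j => f (i, j)) M <= c i) ->
  sum_f_R0 (fun n => f (Cantor.of_nat n)) N <= sum_f_R0 c N.
Proof.
  intros Hf Hc; rewrite (sum_f_R0_lsum (fun n => f (Cantor.of_nat n))), <- lsum_map.
  apply Rle_trans with (lsum f (list_prod (seq 0 (S N)) (seq 0 (S N)))).
  - apply lsum_incl; [exact Hf | |].
    + apply Injective_map_NoDup; [exact Cantor.of_nat_inj | apply seq_NoDup].
    + intros (i, j) H; apply in_map_iff in H; destruct H as (n & E & Hn); apply in_seq in Hn.
      assert (Hij : Cantor.to_nat (i, j) = n) by (rewrite <- E; apply Cantor.cancel_to_of).
      pose proof (Cantor.to_nat_non_decreasing i j).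
      apply in_prod; apply in_seq; lia.
  - rewrite lsum_prod, sum_f_R0_lsum; apply lsum_le; intro i.
    rewrite <- sum_f_R0_lsum; apply Hc.
Qed.

Definition box_ok (b : P4 * P4) : Prop :=
  mu34 (fst b) <= mu34 (snd b) /\ sv (fst b) <= sv (snd b) /\
  mu200 (fst b) <= mu200 (snd b) /\ zv (fst b) <= zv (snd b).

Lemma box_vol_nonneg b : box_ok b -> 0 <= box_vol (fst b) (snd b).
Proof.
  intros (H1 & H2 & H3 & H4); unfold box_vol; repeat apply Rmult_le_pos; lra.
Qed.

Lemma null_union (S : nat -> P4 -> Prop) :
  (forall n, lebesgue_null4 (S n)) -> lebesgue_null4 (fun x => exists n, S n x).
Proof.
  intros HS e He.
  assert (Hex : forall n, exists b : nat -> P4 * P4, (forall k, box_ok (b k)) /\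
     (forall x, S n x -> exists k, in_box (fst (b k)) (snd (b k)) x) /\
     (forall N, sum_f_R0 (fun k => box_vol (fst (b k)) (snd (b k))) N <= e * (/ 2) ^ (n + 1))).
  { intro n; destruct (HS n (e * (/ 2) ^ (n + 1))) as (lo & hi & H1 & H2 & H3).
    - apply Rmult_lt_0_compat; [exact He | apply pow_lt; lra].
    - exists (fun k => (lo k, hi k)); repeat split; try apply H1; auto. }
  pose (b := fun n => proj1_sig (constructive_indefinite_description _ (Hex n))).
  assert (Hb : forall n, (forall k, box_ok (b n k)) /\
     (forall x, S n x -> exists k, in_box (fst (b n k)) (snd (b n k)) x) /\
     (forall N, sum_f_R0 (fun k => box_vol (fst (b n k)) (snd (b n k))) N <= e * (/ 2) ^ (n + 1))).
  { intro n; unfold b; destruct (constructive_indefinite_description _ (Hex n)) as (b' & Hb'); exact Hb'. }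
  pose (c := fun ij : nat * nat => b (fst ij) (snd ij)).
  exists (fun n => fst (c (Cantor.of_nat n))), (fun n => snd (c (Cantor.of_nat n))); split; [|split].
  - intro n; apply (proj1 (Hb _)).
  - intros x (n & Hx); destruct (proj1 (proj2 (Hb n)) x Hx) as (k & Hk).
    exists (Cantor.to_nat (n, k)); rewrite Cantor.cancel_of_to; exact Hk.
  - intro N; apply Rle_trans with (sum_f_R0 (fun n => e * (/ 2) ^ (n + 1)) N).
    + apply (cantor_sum_le (fun ij => box_vol (fst (c ij)) (snd (c ij)))).
      * intro ij; apply box_vol_nonneg, (proj1 (Hb _)).
      * intros i M; apply (proj2 (proj2 (Hb i))).
    + assert (Hs : sum_f_R0 (fun n => e * (/ 2) ^ (n + 1)) N = e * (1 - (/ 2) ^ (N + 1))).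
      { induction N as [|N IH]; [simpl; field|].
        rewrite tech5, IH; replace (Datatypes.S N + 1)%nat with (Datatypes.S (N + 1)) by lia; simpl; field. }
      rewrite Hs; assert (0 < (/ 2) ^ (N + 1)) by (apply pow_lt; lra); nra.
Qed.

Definition cell (w x : R) : nat := Z.to_nat (Int_part (x / w)).

Lemma cell_spec w x : 0 < w -> 0 <= x -> INR (cell w x) * w <= x < (INR (cell w x) + 1) * w.
Proof.
  intros Hw Hx; unfold cell.
  assert (Hq : 0 <= x / w) by (apply Rmult_le_pos; [exact Hx | apply Rlt_le, Rinv_0_lt_compat, Hw]).
  destruct (base_Int_part (x / w)) as (H1 & H2).
  assert (Hz : (0 <= Int_part (x / w))%Z).
  { apply Z.lt_succ_r, lt_IZR; rewrite succ_IZR; lra. }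
  rewrite INR_IZR_INZ, Z2Nat.id by exact Hz.
  assert (E : x = x / w * w) by (field; lra).
  split.
  - rewrite E at 2; apply Rmult_le_compat_r; lra.
  - rewrite E at 1; apply Rmult_lt_compat_r; lra.
Qed.

Lemma cell_lt w x n : 0 < w -> 0 <= x < INR n * w -> (cell w x < n)%nat.
Proof.
  intros Hw Hx; destruct (cell_spec w x Hw (proj1 Hx)) as (H & _).
  apply INR_lt, Rmult_lt_reg_r with w; lra.
Qed.

(* The order of the signed coordinates (-mu34, s, -mu200, z). *)
Definition signed_ll (x y : P4) : Prop :=
  mu34 y < mu34 x /\ sv x < sv y /\ mu200 y < mu200 x /\ zv x < zv y.

Lemma bounded_sum_le (f : nat -> R) (M : nat) (v : R) N : 0 <= v ->
  (forall n, (n < M)%nat -> f n <= v) -> (forall n, (M <= n)%nat -> f n <= 0) ->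
  sum_f_R0 f N <= INR M * v.
Proof.
  intros Hv H1 H2.
  assert (Hs : forall N, sum_f_R0 f N <= INR (Nat.min (S N) M) * v).
  { clear N; induction N as [|N IH].
    - simpl sum_f_R0; destruct M as [|M]; [simpl; specialize (H2 0%nat (le_n 0)); lra|].
      simpl Nat.min; simpl INR; specialize (H1 0%nat ltac:(lia)); lra.
    - rewrite tech5; destruct (Nat.lt_ge_cases (S N) M) as [Hlt | Hge].
      + rewrite Nat.min_l in IH |- * by lia; rewrite (S_INR (S N)); specialize (H1 _ Hlt); lra.
      + rewrite Nat.min_r in IH |- * by lia; specialize (H2 _ Hge); lra. }
  eapply Rle_trans; [apply Hs|]; apply Rmult_le_compat_r; [exact Hv | apply le_INR; lia].
Qed.

Lemma digits_lt N P a b : (a < N)%nat -> (b < P)%nat -> (a + N * b < N * P)%nat.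
Proof. intros Ha Hb; nia. Qed.

Lemma digits_inj N a b a' b' : (a < N)%nat -> (a' < N)%nat ->
  (a + N * b = a' + N * b')%nat -> a = a' /\ b = b'.
Proof. intros Ha Ha' E; assert (b = b') by nia; subst; lia. Qed.

(* Cut the cube into n^4 half-open cells.  Two points of cells on a common diagonal (in the
   direction of the order) lie in the same cell or are comparable, so an antichain meets at most
   one cell on each of the at most (2n)^3 diagonals. *)
Lemma antichain_null (S : P4 -> Prop) (k : nat) :
  (forall x, S x -> 0 <= mu34 x < INR k /\ 0 <= sv x < INR k /\ 0 <= mu200 x < INR k /\ 0 <= zv x < INR k) ->
  (forall x y, S x -> S y -> ~ signed_ll x y) -> lebesgue_null4 S.
Proof.
  intros Hb Ha e He.
  destruct (INR_archimed e (8 * INR k ^ 4) He) as (n0 & Hn0).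
  set (n := Datatypes.S n0).
  assert (Hn : 0 < INR n) by (apply lt_0_INR; unfold n; lia).
  assert (Hne : 8 * INR k ^ 4 <= INR n * e) by (unfold n; rewrite S_INR; lra).
  destruct (Nat.eq_dec k 0) as [-> | Hk0].
  { exists (fun _ => mkP4 0 0 0 0), (fun _ => mkP4 0 0 0 0); split; [|split].
    - intros; simpl; lra.
    - intros x Hx; specialize (Hb x Hx); simpl in Hb; lra.
    - intro N; apply Rle_trans with 0; [|lra].
      rewrite <- (sum_eq_R0 (fun _ : nat => 0) N) by reflexivity.
      right; apply sum_eq; intros; unfold box_vol; simpl; ring. }
  assert (Hk : 0 < INR k) by (apply lt_0_INR; lia).
  set (w := INR k / INR n); assert (Hw : 0 < w) by (apply Rdiv_lt_0_compat; assumption).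
  assert (Hnw : INR n * w = INR k) by (unfold w; field; lra).
  pose (c := cell w).
  pose (d1 := fun x => (c (mu34 x) + c (sv x))%nat).
  pose (d2 := fun x => (c (mu200 x) + c (sv x))%nat).
  pose (d3 := fun x => (c (zv x) + (n - c (sv x)))%nat).
  pose (code := fun x => (d1 x + (2 * n) * (d2 x + (2 * n) * d3 x))%nat).
  assert (Hc : forall x, S x -> (c (mu34 x) < n /\ c (sv x) < n /\ c (mu200 x) < n /\ c (zv x) < n)%nat).
  { intros x Hx; destruct (Hb x Hx) as (? & ? & ? & ?).
    repeat split; apply cell_lt; rewrite ?Hnw; assumption. }
  assert (Hd : forall x, S x -> (d1 x < 2 * n /\ d2 x < 2 * n /\ d3 x < 2 * n)%nat).
  { intros x Hx; specialize (Hc x Hx); unfold d1, d2, d3; lia. }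
  assert (Hll : forall x y j, S x -> S y -> (1 <= j)%nat ->
    c (sv y) = (c (sv x) + j)%nat -> c (zv y) = (c (zv x) + j)%nat ->
    c (mu34 x) = (c (mu34 y) + j)%nat -> c (mu200 x) = (c (mu200 y) + j)%nat -> False).
  { intros x y j Hx Hy Hj E2 E4 E1 E3; apply (Ha x y Hx Hy).
    assert (Hlt : forall a b, 0 <= a -> 0 <= b -> c b = (c a + j)%nat -> a < b).
    { intros a b Ha0 Hb0 E; destruct (cell_spec w a Hw Ha0) as (_ & H1).
      destruct (cell_spec w b Hw Hb0) as (H2 & _); fold c in H1, H2.
      rewrite E, plus_INR in H2.
      assert (1 <= INR j) by (apply (le_INR 1); exact Hj). nra. }
    destruct (Hb x Hx) as (? & ? & ? & ?), (Hb y Hy) as (? & ? & ? & ?).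
    repeat split; apply Hlt; try assumption; lra. }
  assert (Hcode : forall x y, S x -> S y -> code x = code y ->
    c (mu34 x) = c (mu34 y) /\ c (sv x) = c (sv y) /\ c (mu200 x) = c (mu200 y) /\ c (zv x) = c (zv y)).
  { intros x y Hx Hy E; destruct (Hd x Hx) as (A1 & A2 & A3), (Hd y Hy) as (B1 & B2 & B3).
    apply digits_inj in E; [|assumption|assumption]; destruct E as (E1 & E).
    apply digits_inj in E; [|assumption|assumption]; destruct E as (E2 & E3).
    specialize (Hc x Hx) as Hcx; specialize (Hc y Hy) as Hcy; unfold d1, d2, d3 in *.
    destruct (Nat.lt_trichotomy (c (sv x)) (c (sv y))) as [Hlt | [Heq | Hlt]].
    - exfalso; apply (Hll x y (c (sv y) - c (sv x))%nat); auto; lia.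
    - lia.
    - exfalso; apply (Hll y x (c (sv x) - c (sv y))%nat); auto; lia. }
  assert (Hex : forall m, exists b : P4 * P4, box_ok b /\
    (forall x, S x -> code x = m -> in_box (fst b) (snd b) x) /\
    box_vol (fst b) (snd b) <= w ^ 4 /\
    ((2 * n * (2 * n * (2 * n)) <= m)%nat -> box_vol (fst b) (snd b) <= 0)).
  { intro m; pose proof (pow_lt w 4 Hw) as Hw4.
    destruct (classic (exists x, S x /\ code x = m)) as [(x & Hx & Hm) | Hno].
    - pose (lw := fun a => INR (c a) * w); pose (up := fun a => (INR (c a) + 1) * w).
      exists (mkP4 (lw (mu34 x)) (lw (sv x)) (lw (mu200 x)) (lw (zv x)),
              mkP4 (up (mu34 x)) (up (sv x)) (up (mu200 x)) (up (zv x))).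
      assert (Hlu : forall a, lw a <= up a) by (intro a; unfold lw, up; lra).
      split; [exact (conj (Hlu _) (conj (Hlu _) (conj (Hlu _) (Hlu _))))|]; split; [|split].
      + intros y Hy Hym; destruct (Hcode x y Hx Hy) as (E1 & E2 & E3 & E4); [congruence|].
        assert (Hin : forall a b, 0 <= b -> c a = c b -> lw a <= b <= up a).
        { intros a b Hb0 E; unfold lw, up; rewrite E; destruct (cell_spec w b Hw Hb0) as (? & ?).
          unfold c; lra. }
        destruct (Hb y Hy) as ((B1 & _) & (B2 & _) & (B3 & _) & (B4 & _)).
        exact (conj (Hin _ _ B1 E1) (conj (Hin _ _ B2 E2) (conj (Hin _ _ B3 E3) (Hin _ _ B4 E4)))).
      + unfold box_vol, lw, up; simpl; right; ring.
      + intro Hge; exfalso; destruct (Hd x Hx) as (A1 & A2 & A3).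
        apply (proj1 (Nat.le_ngt _ _) Hge); rewrite <- Hm; apply digits_lt; [exact A1|].
        apply digits_lt; assumption.
    - exists (mkP4 0 0 0 0, mkP4 0 0 0 0); split; [|split; [|split]].
      + unfold box_ok; simpl; lra.
      + intros x Hx Hm; exfalso; apply Hno; exists x; auto.
      + unfold box_vol; simpl fst; simpl snd; simpl mu34; simpl sv; simpl mu200; simpl zv; lra.
      + intros _; unfold box_vol; simpl; lra. }
  pose (b := fun m => proj1_sig (constructive_indefinite_description _ (Hex m))).
  assert (Hbm : forall m, box_ok (b m) /\
    (forall x, S x -> code x = m -> in_box (fst (b m)) (snd (b m)) x) /\
    box_vol (fst (b m)) (snd (b m)) <= w ^ 4 /\
    ((2 * n * (2 * n * (2 * n)) <= m)%nat -> box_vol (fst (b m)) (snd (b m)) <= 0)).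
  { intro m; unfold b; destruct (constructive_indefinite_description _ (Hex m)) as (b' & Hb'); exact Hb'. }
  exists (fun m => fst (b m)), (fun m => snd (b m)); split; [|split].
  - intro m; apply (proj1 (Hbm m)).
  - intros x Hx; exists (code x); apply (Hbm (code x)); auto.
  - intro N; apply Rle_trans with (INR (2 * n * (2 * n * (2 * n))) * w ^ 4).
    + apply bounded_sum_le.
      * apply pow_le; lra.
      * intros m _; apply (Hbm m).
      * intros m Hm; apply (Hbm m), Hm.
    + rewrite !mult_INR; change (INR 2) with 2.
      replace (2 * INR n * (2 * INR n * (2 * INR n)) * w ^ 4) with (8 * INR k ^ 4 / INR n)
        by (unfold w; field; lra).
      apply Rmult_le_reg_r with (INR n); [exact Hn|].
      replace (8 * INR k ^ 4 / INR n * INR n) with (8 * INR k ^ 4) by (field; lra); lra.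
Qed.

(** * Generic convergence *)

Lemma dist4_near x y r : dist4 x y < r <-> near r (toV x) (toV y).
Proof.
  unfold dist4; split.
  - intros H; apply Rmax_Rlt in H; destruct H as (H1 & H2).
    apply Rmax_Rlt in H1; apply Rmax_Rlt in H2.
    intros [| | |]; simpl; try tauto.
    + replace (- mu34 x - - mu34 y) with (- (mu34 x - mu34 y)) by ring; rewrite Rabs_Ropp; tauto.
    + replace (- mu200 x - - mu200 y) with (- (mu200 x - mu200 y)) by ring; rewrite Rabs_Ropp; tauto.
  - intro H; pose proof (H X1) as H1; pose proof (H X2) as H2; pose proof (H X3) as H3;
    pose proof (H X4) as H4; simpl in *.
    replace (- mu34 x - - mu34 y) with (- (mu34 x - mu34 y)) in H1 by ring; rewrite Rabs_Ropp in H1.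
    replace (- mu200 x - - mu200 y) with (- (mu200 x - mu200 y)) in H3 by ring; rewrite Rabs_Ropp in H3.
    repeat apply Rmax_lub_lt; assumption.
Qed.

(* Freezing the solution at negative times makes it continuous on the whole line. *)
Definition signed_path (phi : R -> P4) : traj := fun t => toV (phi (Rmax 0 t)).

Lemma forward_solution_sol p phi x0 : forward_solution p phi x0 ->
  sol signed_orthant (signed_field p) (signed_path phi).
Proof.
  intros (E0 & Horth & Hder & Hcont).
  assert (Hd : forall i t, 0 < t ->
     derivable_pt_lim (fun u => toV (phi u) i) t (signed_field p (toV (phi t)) i)).
  { intros i t Ht; destruct (Hder t Ht) as (H1 & H2 & H3 & H4).
    unfold signed_field; rewrite ofV_toV; destruct i; unfold toV.
    - apply (derivable_pt_lim_opp (fun u => mu34 (phi u))), H1.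
    - exact H2.
    - apply (derivable_pt_lim_opp (fun u => mu200 (phi u))), H3.
    - exact H4. }
  assert (Hd' : forall i t, 0 < t -> derivable_pt_lim (fun u => signed_path phi u i) t
                                   (signed_field p (signed_path phi t) i)).
  { intros i t Ht; unfold signed_path; rewrite (Rmax_right 0 t) by lra.
    apply (derivable_pt_lim_locally_ext (fun u => toV (phi u) i) _ t 0 (t + 1)); [lra | | apply Hd, Ht].
    intros z Hz; rewrite Rmax_right by lra; reflexivity. }
  split; [|split; [|exact Hd']].
  - intros t Ht; unfold signed_orthant, signed_path; rewrite ofV_toV; apply Horth, Rmax_l.
  - intros i t; destruct (Rlt_le_dec 0 t) as [Ht | Ht].
    + apply derivable_continuous_pt; eexists; apply (Hd' i t Ht).
    + intros e He; destruct (Hcont e He) as (d & Hdp & H); exists d; split; [exact Hdp|].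
      intros s (_ & Hs); simpl in *; unfold Rdist in *; unfold signed_path.
      rewrite (Rmax_left 0 t) by lra; rewrite E0.
      apply dist4_near, H; split; [apply Rmax_l|].
      apply Rmax_lub_lt; [exact Hdp|].
      apply Rabs_def2 in Hs; lra.
Qed.

Definition box_lo (d M : R) : V := fun i => match i with X1 | X3 => - M | X2 | X4 => d end.
Definition box_hi (d M : R) : V := fun i => match i with X1 | X3 => - d | X2 | X4 => M end.

Definition orbits (p : Params) (d M : R) : traj -> Prop :=
  bsol signed_orthant (signed_field p) (box_lo d M) (box_hi d M).

Lemma orbits_strongly_monotone p d M : params_ok p -> 0 < d -> strongly_monotone (orbits p d M).
Proof.
  intros Hp Hd; destruct (signed_field_cooperative p Hp) as (K & HK).
  apply (bsol_strongly_monotone K); [exact HK|].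
  intros u Hu; pose proof (Hu X1); pose proof (Hu X2); pose proof (Hu X3); pose proof (Hu X4).
  simpl in *; unfold signed_orthant, in_orthant; simpl; lra.
Qed.

Lemma orbits_widen p d M d' M' x : d' <= d -> M <= M' -> orbits p d M x -> orbits p d' M' x.
Proof.
  intros Hd HM (Hs & Hb); split; [exact Hs|].
  intros t Ht i; specialize (Hb t Ht i); destruct i; simpl in *; lra.
Qed.

Definition limits_to_equilibrium (p : Params) (x : traj) : Prop :=
  exists e, equilibrium p (ofV e) /\
    forall r, 0 < r -> exists T0, forall t, T0 <= t -> 0 <= t -> near r (x t) e.

Lemma stationary_equilibrium p d M q : stationary_point (orbits p d M) q -> equilibrium p (ofV q).
Proof.
  intros (al & e & ((Da & _ & La) & _) & E0 & He & Hst); split.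
  - rewrite <- E0; apply Da; lra.
  - assert (HF : forall i, signed_field p q i = 0).
    { intro i; specialize (La i (e / 2) ltac:(lra)).
      rewrite (Hst (e / 2)) in La by lra.
      eapply uniqueness_limite; [exact La|].
      apply (derivable_pt_lim_locally_ext (fct_cte (q i)) _ (e / 2) 0 e); [lra | |].
      - intros z Hz; rewrite Hst by lra; reflexivity.
      - apply derivable_pt_lim_const. }
    pose proof (HF X1) as H1; pose proof (HF X2) as H2; pose proof (HF X3) as H3; pose proof (HF X4) as H4.
    unfold signed_field, toV in *; destruct (G p (ofV q)) as [a b c f]; cbn in *; f_equal; lra.
Qed.

Lemma single_limit_equilibrium p d M x : params_ok p -> 0 < d -> orbits p d M x ->
  (exists e, forall q, Om x q -> q = e) -> limits_to_equilibrium p x.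
Proof.
  intros Hp Hd Tx (e & He).
  pose proof (orbits_strongly_monotone p d M Hp Hd) as SM.
  destruct (Om_nonempty _ SM x Tx) as (z & Hz).
  pose proof (He z Hz); subst z.
  exists e; split; [|exact (Om_unique_converges _ SM x e Tx He)].
  destruct (sm_limit _ SM x e Tx Hz) as (al & Ta & Ea).
  apply (stationary_equilibrium p d M); exists al, 1.
  split; [exact Ta|]; split; [exact Ea|]; split; [lra|].
  intros h Hh; apply He; apply (Om_flow _ SM x al h); auto; [rewrite Ea; exact Hz | lra].
Qed.

Lemma stationary_limits_converge p d M x : params_ok p -> 0 < d ->
  totally_disconnected4 (equilibrium p) -> orbits p d M x ->
  (forall q, Om x q -> stationary_point (orbits p d M) q) -> limits_to_equilibrium p x.
Proof.
  intros Hp Hd Htd Tx Hst.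
  pose proof (orbits_strongly_monotone p d M Hp Hd) as SM.
  apply (single_limit_equilibrium p d M); auto.
  destruct (Om_nonempty _ SM x Tx) as (z & Hz); exists z; intros q Hq.
  rewrite <- (toV_ofV q), <- (toV_ofV z); f_equal.
  apply (Htd (fun y => Om x (toV y))); try (rewrite toV_ofV; assumption).
  - intros y Hy; rewrite <- (ofV_toV y); apply (stationary_equilibrium p d M), Hst, Hy.
  - intros (U & W & HU & HW & Hcov & (y1 & Hy1 & Uy1) & (y2 & Hy2 & Wy2) & Hdis).
    assert (Hop : forall A, open4 A -> forall u, A (ofV u) ->
       exists r, 0 < r /\ forall v, near r u v -> A (ofV v)).
    { intros A HA u Hu; destruct (HA _ Hu) as (r & Hr & Hrr); exists r; split; [exact Hr|].
      intros v Hv; apply Hrr, dist4_near; rewrite !toV_ofV; exact Hv. }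
    apply (Om_connected _ SM x (fun u => U (ofV u)) (fun u => W (ofV u)) Tx
             (Hop U HU) (Hop W HW)) with (p := toV y1) (q := toV y2); try rewrite ofV_toV; auto.
    + intros u Hu; apply Hcov; rewrite toV_ofV; exact Hu.
    + intros u Hu; apply Hdis; rewrite toV_ofV; exact Hu.
Qed.

Lemma nonconvergent_limits_ordered p d M x y : params_ok p -> 0 < d ->
  totally_disconnected4 (equilibrium p) -> orbits p d M x -> orbits p d M y ->
  vll (x 0) (y 0) -> ~ limits_to_equilibrium p y ->
  forall a b, Om x a -> Om y b -> vle a b.
Proof.
  intros Hp Hd Htd Tx Ty Hll Hn.
  destruct (limit_set_dichotomy _ (orbits_strongly_monotone p d M Hp Hd) x y Tx Ty Hll)
    as [H | [H | H]]; [|exact H|]; exfalso; apply Hn.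
  - exact (single_limit_equilibrium p d M y Hp Hd Ty H).
  - exact (stationary_limits_converge p d M y Hp Hd Htd Ty H).
Qed.

Definition bad_orbit (p : Params) (x0 : P4) (x : traj) : Prop :=
  (exists d M, 0 < d /\ orbits p d M x) /\ x 0 = toV x0 /\ ~ limits_to_equilibrium p x.

Lemma bad_orbit_exists p phi x0 : params_ok p -> Wc p x0 -> forward_solution p phi x0 ->
  ~ (exists e, equilibrium p e /\ converges_to phi e) -> exists x, bad_orbit p x0 x.
Proof.
  intros Hp (psi & Hpsi & d & M & Hd & Hbox) Hphi Hn.
  pose proof (forward_solution_sol p psi x0 Hpsi) as Spsi.
  pose proof (forward_solution_sol p phi x0 Hphi) as Sphi.
  assert (E0 : signed_path psi 0 = toV x0).
  { unfold signed_path; rewrite Rmax_left by lra; f_equal; apply Hpsi. }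
  assert (E0' : signed_path phi 0 = toV x0).
  { unfold signed_path; rewrite Rmax_left by lra; f_equal; apply Hphi. }
  exists (signed_path psi); split; [|split; [exact E0|]].
  - exists d, M; split; [exact Hd|]; split; [exact Spsi|].
    intros t Ht i; unfold signed_path; rewrite Rmax_right by lra.
    specialize (Hbox t Ht); destruct i; simpl; lra.
  - intros (e & He & Hlim); apply Hn; exists (ofV e); split; [exact He|].
    destruct (signed_field_cooperative p Hp) as (K & HK).
    intros r Hr; destruct (Hlim r Hr) as (T0 & HT); exists (Rmax T0 0); intros t Ht.
    pose proof (Rmax_l T0 0); pose proof (Rmax_r T0 0).
    apply dist4_near; rewrite toV_ofV.
    specialize (HT t ltac:(lra) ltac:(lra)).
    rewrite (sol_unique K _ _ HK (signed_path psi) (signed_path phi) t) in HT; auto; try congruence; try lra.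
    unfold signed_path in HT; rewrite Rmax_right in HT by lra; exact HT.
Qed.

Definition ratio (a b m : nat) : R := (INR a - INR b) / (INR m + 1).

Lemma ratio_dense x y : x < y -> exists a b m, x < ratio a b m < y.
Proof.
  intro Hxy; destruct (INR_archimed (y - x) 1) as (m & Hm); [lra|].
  pose proof (pos_INR m).
  set (q := INR m + 1); assert (Hq : 0 < q) by (unfold q; lra).
  destruct (archimed (q * x)) as (H1 & H2).
  set (z := up (q * x)) in *.
  exists (Z.to_nat z), (Z.to_nat (- z)), m.
  assert (E : ratio (Z.to_nat z) (Z.to_nat (- z)) m = IZR z / q).
  { unfold ratio; fold q; f_equal; rewrite !INR_IZR_INZ, <- minus_IZR; f_equal; lia. }
  rewrite E; split; apply Rmult_lt_reg_r with q; auto;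
  replace (IZR z / q * q) with (IZR z) by (field; lra); unfold q in *; nra.
Qed.

Lemma bad_orbit_oscillates p x0 x : params_ok p -> bad_orbit p x0 x ->
  exists i a b m u v, Om x u /\ Om x v /\ u i < ratio a b m < v i.
Proof.
  intros Hp ((d & M & Hd & Tx) & _ & Hn).
  pose proof (orbits_strongly_monotone p d M Hp Hd) as SM.
  destruct (Om_nonempty _ SM x Tx) as (z & Hz).
  assert (Hw : exists w, Om x w /\ w <> z).
  { apply NNPP; intro Hno; apply Hn, (single_limit_equilibrium p d M); auto.
    exists z; intros w Hw; apply NNPP; intro; apply Hno; exists w; auto. }
  destruct Hw as (w & Hw & Hne).
  assert (Hi : exists i, w i <> z i).
  { apply NNPP; intro Hno; apply Hne, vext; intro i; apply NNPP; intro; apply Hno; exists i; auto. }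
  destruct Hi as (i & Hi); exists i.
  destruct (Rdichotomy _ _ Hi) as [Hlt | Hlt]; destruct (ratio_dense _ _ Hlt) as (a & b & m & Hr);
    exists a, b, m; [exists w, z | exists z, w]; auto.
Qed.

Definition coord (n : nat) : ix := match n with 0 => X1 | 1 => X2 | 2 => X3 | _ => X4 end%nat.

Definition bad_piece (p : Params) (n a b m k : nat) (x0 : P4) : Prop :=
  (0 <= mu34 x0 < INR k /\ 0 <= sv x0 < INR k /\ 0 <= mu200 x0 < INR k /\ 0 <= zv x0 < INR k) /\
  exists x u v, bad_orbit p x0 x /\ Om x u /\ Om x v /\ u (coord n) < ratio a b m < v (coord n).

Lemma bad_piece_null p n a b m k : params_ok p -> totally_disconnected4 (equilibrium p) ->
  lebesgue_null4 (bad_piece p n a b m k).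
Proof.
  intros Hp Htd; apply (antichain_null _ k).
  - intros x (Hx & _); exact Hx.
  - intros x0 y0 (_ & x & u & v & ((d & M & Hd & Tx) & Ex & _) & _ & Hv & Huv)
      (_ & y & u' & v' & ((d' & M' & Hd' & Ty) & Ey & Hny) & Hu' & _ & Huv') (L1 & L2 & L3 & L4).
    assert (Hle : vle v u').
    { apply (nonconvergent_limits_ordered p (Rmin d d') (Rmax M M') x y); auto.
      - apply Rmin_glb_lt; assumption.
      - apply (orbits_widen p d M); auto; [apply Rmin_l | apply Rmax_l].
      - apply (orbits_widen p d' M'); auto; [apply Rmin_r | apply Rmax_r].
      - rewrite Ex, Ey; intros [| | |]; simpl; lra. }
    specialize (Hle (coord n)); lra.
Qed.

Theorem theorem4 (p : Params) :
  params_ok p ->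
  totally_disconnected4 (equilibrium p) ->
  lebesgue_null4 (fun x0 => Wc p x0 /\
    exists phi, forward_solution p phi x0 /\
      ~ (exists e, equilibrium p e /\ converges_to phi e)).
Proof.
  intros Hp Htd.
  apply (null_subset _ (fun x0 => exists n a b m k, bad_piece p n a b m k x0)).
  - intros x0 (HW & phi & Hphi & Hn).
    destruct (bad_orbit_exists p phi x0 Hp HW Hphi Hn) as (x & Hx).
    destruct (bad_orbit_oscillates p x0 x Hp Hx) as (i & a & b & m & u & v & Hu & Hv & Huv).
    assert (Hi : exists n, coord n = i).
    { destruct i; [exists 0%nat | exists 1%nat | exists 2%nat | exists 3%nat]; reflexivity. }
    destruct Hi as (n & <-).
    assert (Ho : in_orthant x0).
    { destruct Hphi as (<- & Ho & _); apply Ho; lra. }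
    destruct Ho as (H1 & H2 & H3 & H4).
    destruct (INR_archimed 1 (mu34 x0 + sv x0 + mu200 x0 + zv x0)) as (k & Hk); [lra|].
    exists n, a, b, m, k; split; [lra|].
    exists x, u, v; auto.
  - repeat (apply null_union; intro); apply bad_piece_null; assumption.
Qed.
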